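(* Let $0\le\beta\le1$. Then $C_\beta[f]\in\mathcal{C}$ for every $f\in\mathcal{C}$.
   Context: $\mathbb{D}$ is the open unit disk; $\mathcal{A}$ the class of analytic $f$ on $\mathbb{D}$ with $f(0)=0$, $f'(0)=1$. $\mathcal{K}$ is the class of $f\in\mathcal{A}$ with $f'\neq0$ and $\mathrm{Re}\,(1+zf''(z)/f'(z))>0$ on $\mathbb{D}$ (normalized convex functions). $\mathcal{C}$ is the class of close-to-convex functions: $f\in\mathcal{A}$ such that $\mathrm{Re}\,(e^{i\alpha}f'(z)/g'(z))>0$ on $\mathbb{D}$ for some $g\in\mathcal{K}$ and some real $\alpha\in(-\pi/2,\pi/2)$. For $\beta\ge0$ and $f$ analytic on $\mathbb{D}$ with $f(0)=0$, $C_\beta[f](z)=\int_0^z \frac{f(w)}{w(1-w)^\beta}\,dw$ (principal branch of $(1-w)^\beta$). *)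

(* Defs.v *)
From HB Require Import structures.
From mathcomp Require Import all_boot all_order all_algebra.
From mathcomp Require Import all_classical all_reals all_analysis.
From mathcomp Require Import complex.
Import Order.TTheory GRing.Theory Num.Theory.
Import numFieldNormedType.Exports.
Local Open Scope ring_scope.
Local Open Scope complex_scope.

Set Implicit Arguments.
Unset Strict Implicit.
Unset Printing Implicit Defensive.

Section Defs.
Variable R : realType.

(* The complex plane, viewed as a normed module over itself, so that
   [derivable f z 1] / ['D_1 f z] are COMPLEX differentiability / derivative. *)
Notation C := (R[i])^o.

Definition ReC (z : R[i]) : R := complex.Re z.
Definition ImC (z : R[i]) : R := complex.Im z.
Definition modC (z : R[i]) : R := Num.sqrt (ReC z ^+ 2 + ImC z ^+ 2).

Definition in_disk (z : R[i]) : Prop := modC z < 1.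

Definition analytic_on_disk (f : C -> C) : Prop :=
  forall z : R[i], in_disk z -> derivable f z 1.

Definition cderiv (f : C -> C) : C -> C := fun z => 'D_1 f z.

Definition classA (f : C -> C) : Prop :=
  analytic_on_disk f /\ f 0 = 0 /\ cderiv f 0 = 1.

Definition classK (f : C -> C) : Prop :=
  classA f /\
  (forall z, in_disk z -> cderiv f z != 0) /\
  (forall z, in_disk z ->
     0 < ReC (1 + z * cderiv (cderiv f) z / cderiv f z)).

Definition expi (a : R) : R[i] := cos a +i* sin a.

Definition close_to_convex (f : C -> C) : Prop :=
  classA f /\
  exists g : C -> C, classK g /\
  exists alpha : R, - (pi / 2) < alpha < pi / 2 /\
    forall z, in_disk z -> 0 < ReC (expi alpha * cderiv f z / cderiv g z).

Definition Arg (u : R[i]) : R :=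
  let a := ReC u in let b := ImC u in
  if 0 < a then atan (b / a)
  else if a < 0 then (if 0 <= b then atan (b / a) + pi else atan (b / a) - pi)
  else if 0 < b then pi / 2
  else if b < 0 then - (pi / 2) else 0.

Definition cpow (u : R[i]) (beta : R) : R[i] :=
  if u == 0 then 0
  else ((modC u `^ beta)%:C * expi (beta * Arg u)).

(* F = C_beta[f] (z) = int_0^z f(w) / (w (1-w)^beta) dw on the disk:
   F is the (unique) analytic primitive on the (simply connected) disk
   vanishing at 0 of the integrand, whose singularity at w = 0 is removable. *)
Definition is_Cbeta (beta : R) (f F : C -> C) : Prop :=
  analytic_on_disk F /\ F 0 = 0 /\
  forall w : R[i], in_disk w -> w != 0 ->
    cderiv F w = f w / (w * cpow (1 - w) beta).

End Defs.

(* Main.v *)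
Require Import Defs.
From HB Require Import structures.
From mathcomp Require Import all_boot all_order all_algebra.
From mathcomp Require Import all_classical all_reals all_analysis.
From mathcomp Require Import complex ring lra.
Import Order.TTheory GRing.Theory Num.Theory.
Import numFieldNormedType.Exports.
Local Open Scope ring_scope.
Local Open Scope complex_scope.
Set Implicit Arguments.
Unset Strict Implicit.
Unset Printing Implicit Defensive.

(* Let [f] be close-to-convex with respect to the convex function [g] and the
   angle [alpha].  Marx and Strohhaecker: [Re (z g'/g) > 1/2]; Libera:
   [Re (e^{i alpha} f/g) > 0].  Both follow by looking at a first point of the
   disk where the inequality degenerates.  The function [h] with
   [h' = (g/z)(1-z)^{-beta}] then satisfies
   [1 + z h''/h' = z g'/g + beta z/(1-z)], of real part greater than
   [1/2 - beta/2 >= 0], so [h] is convex, and [C_beta[f]'/h' = f/g].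

   Analyticity being mere complex differentiability, this rests on Goursat's
   theorem for rectangles with an exceptional point, which yields primitives on
   disks, hence Cauchy's formula (integrate the primitive of
   [(f(w) - f(z))/(w - z)] around a circle), the analyticity of derivatives,
   the removal of singularities and the maximum principle. *)

(** * The complex plane *)

(* Without this instance, differentiation and limits in the complex variable
   would be available only through the alias [R[i]^o]. *)
HB.instance Definition _ (R : realType) := NormedModule.copy R[i] R[i]^o.

Section Modulus.
Variable R : realType.
Implicit Types z w : R[i].

Lemma norm_modC z : `|z| = (modC z)%:C.
Proof. by rewrite normc_def. Qed.

Lemma modC_ge0 z : 0 <= modC z.
Proof. exact: sqrtr_ge0. Qed.

Lemma modC_sqr z : modC z ^+ 2 = complex.Re z ^+ 2 + complex.Im z ^+ 2.
Proof. by rewrite sqr_sqrtr // addr_ge0 ?sqr_ge0. Qed.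

Lemma modC0 : modC (0 : R[i]) = 0.
Proof. by apply: complexI; rewrite -norm_modC normr0. Qed.

Lemma modC0_lt1 : modC (0 : R[i]) < 1.
Proof. by rewrite modC0. Qed.

Lemma modC1 : modC (1 : R[i]) = 1.
Proof. by apply: complexI; rewrite -norm_modC normr1. Qed.

Lemma modC_eq0 z : (modC z == 0) = (z == 0).
Proof. by rewrite -[RHS]normr_eq0 norm_modC -(inj_eq (@complexI R)). Qed.

Lemma modC_gt0 z : (0 < modC z) = (z != 0).
Proof. by rewrite lt_def modC_ge0 andbT modC_eq0. Qed.

Lemma modCM z w : modC (z * w) = modC z * modC w.
Proof. by apply: complexI; rewrite rmorphM /= -!norm_modC normrM. Qed.

Lemma modCX z n : modC (z ^+ n) = modC z ^+ n.
Proof. by apply: complexI; rewrite rmorphXn /= -!norm_modC normrX. Qed.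

Lemma modCV z : modC z^-1 = (modC z)^-1.
Proof. by apply: complexI; rewrite fmorphV /= -!norm_modC normfV. Qed.

Lemma modCN z : modC (- z) = modC z.
Proof. by apply: complexI; rewrite -!norm_modC normrN. Qed.

Lemma modCBC z w : modC (z - w) = modC (w - z).
Proof. by rewrite -modCN opprB. Qed.

Lemma modCD z w : modC (z + w) <= modC z + modC w.
Proof. by rewrite -lecR rmorphD /= -!norm_modC ler_normD. Qed.

Lemma modCB z w : modC (z - w) <= modC z + modC w.
Proof. by rewrite -(modCN w); exact: modCD. Qed.

Lemma ler_modCB z w : modC z - modC w <= modC (z - w).
Proof. by rewrite lerBlDr -[X in modC X <= _](subrK w); exact: modCD. Qed.

Lemma ler_dist_modC z w : `|modC z - modC w| <= modC (z - w).
Proof. by rewrite ler_norml ler_modCB andbT lerNl opprB modCBC ler_modCB. Qed.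

Lemma modC_real (x : R) : modC x%:C = `|x|.
Proof. by rewrite /modC /= expr0n addr0 sqrtr_sqr. Qed.

Lemma modC_nat n : modC (n%:R : R[i]) = n%:R.
Proof. by rewrite -(rmorph_nat (real_complex R)) modC_real ger0_norm. Qed.

Lemma modCi : modC ('i : R[i]) = 1.
Proof. by rewrite /modC /= expr0n add0r expr1n sqrtr1. Qed.

Lemma Re_le_modC z : `|complex.Re z| <= modC z.
Proof.
rewrite -ler_sqr ?nnegrE ?modC_ge0 // modC_sqr real_normK ?num_real //.
by rewrite lerDl sqr_ge0.
Qed.

Lemma Im_le_modC z : `|complex.Im z| <= modC z.
Proof.
rewrite -ler_sqr ?nnegrE ?modC_ge0 // modC_sqr real_normK ?num_real //.
by rewrite lerDr sqr_ge0.
Qed.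

Lemma modC_le_ReIm z : modC z <= `|complex.Re z| + `|complex.Im z|.
Proof.
rewrite [z in modC z]complexE (le_trans (modCD _ _)) //.
by rewrite modCM modCi mul1r !modC_real.
Qed.

Lemma le_modC z w : `|complex.Re z| <= `|complex.Re w| ->
  `|complex.Im z| <= `|complex.Im w| -> modC z <= modC w.
Proof.
move=> zwr zwi; rewrite -ler_sqr ?nnegrE ?modC_ge0 // !modC_sqr.
by rewrite lerD // -[leLHS]real_normK ?num_real // -[leRHS]real_normK ?num_real //
  ler_sqr ?nnegrE.
Qed.

Lemma Re_add z w : complex.Re (z + w) = complex.Re z + complex.Re w.
Proof. by case: z; case: w. Qed.
Lemma Im_add z w : complex.Im (z + w) = complex.Im z + complex.Im w.
Proof. by case: z; case: w. Qed.
Lemma Re_opp z : complex.Re (- z) = - complex.Re z. Proof. by case: z. Qed.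
Lemma Im_opp z : complex.Im (- z) = - complex.Im z. Proof. by case: z. Qed.
Lemma Re_mul z w : complex.Re (z * w) =
  complex.Re z * complex.Re w - complex.Im z * complex.Im w.
Proof. by case: z; case: w. Qed.
Lemma Im_mul z w : complex.Im (z * w) =
  complex.Re z * complex.Im w + complex.Im z * complex.Re w.
Proof. by case: z; case: w. Qed.
Definition ReImE := (Re_add, Im_add, Re_opp, Im_opp, Re_mul, Im_mul).

Lemma complex_ext z w :
  complex.Re z = complex.Re w -> complex.Im z = complex.Im w -> z = w.
Proof. by case: z; case: w => /= a b c d -> ->. Qed.

Lemma modC_eq0_eps z (K : R) : (forall e, 0 < e <= 1 -> modC z <= e * K) -> z = 0.
Proof.
move=> zK; apply/eqP; rewrite -modC_eq0 eq_le modC_ge0 andbT leNgt.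
apply/negP => z0; have K0 : 0 < K.
  by rewrite (lt_le_trans z0) // (le_trans (zK 1 _)) ?mul1r // ltr01 lexx.
pose e := Num.min 1 (modC z / (2 * K)).
have e0 : 0 < e by rewrite lt_min ltr01 divr_gt0 ?mulr_gt0.
have := zK e; rewrite e0 ge_min lexx => /(_ isT); apply/negP; rewrite -ltNge.
rewrite -ltr_pdivlMr // gt_min; apply/orP; right.
by rewrite ltr_pM2l // ltf_pV2 ?posrE ?mulr_gt0 //; lra.
Qed.

End Modulus.

Section PlaneTopology.
Local Open Scope classical_set_scope.
Variable R : realType.
Implicit Types z w : R[i].

Lemma nbhs_modCP z (P : set R[i]) :
  nbhs z P <-> exists2 d : R, 0 < d & forall w, modC (w - z) < d -> P w.
Proof.
split=> [/nbhs_ballP[[d d'] /=]|[d d0 dP]].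
  rewrite ltcE /= => /andP[/eqP -> d0] dP; exists d => // w wd.
  by apply: dP; rewrite /ball /= norm_modC ltcR modCBC.
apply/nbhs_ballP; exists d%:C; first by rewrite /= ltcR.
by move=> w; rewrite /ball /= norm_modC ltcR modCBC; exact: dP.
Qed.

Lemma continuous_le_modC (u : R[i] -> R) :
  (forall z w, `|u z - u w| <= modC (z - w)) -> continuous u.
Proof.
move=> u1 z; apply/(@cvgrPdist_lt _ R _ (nbhs z)) => e e0; apply/nbhs_modCP.
by exists e => // w; rewrite modCBC; exact: le_lt_trans.
Qed.

Lemma continuous_Re : continuous (@complex.Re R).
Proof. by apply: continuous_le_modC => z w; rewrite -Re_opp -Re_add Re_le_modC. Qed.

Lemma continuous_Im : continuous (@complex.Im R).
Proof. by apply: continuous_le_modC => z w; rewrite -Im_opp -Im_add Im_le_modC. Qed.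

Lemma continuous_modC : continuous (@modC R).
Proof. by apply: continuous_le_modC; exact: ler_dist_modC. Qed.

Lemma continuous_modCP (T : topologicalType) (f : T -> R[i]) t :
  {for t, continuous f} <->
  forall e : R, 0 < e -> \forall s \near t, modC (f s - f t) < e.
Proof.
split=> [cf e e0|cf P /nbhs_modCP[d d0 dP]].
  by apply: (cf [set w | modC (w - f t) < e]); apply/nbhs_modCP; exists e.
by apply: filterS (cf d d0) => s; exact: dP.
Qed.

Lemma continuous_real_complex : continuous (real_complex R).
Proof.
move=> x; apply/continuous_modCP => e e0; apply/nbhs_ballP; exists e => // y.
by rewrite /ball /= -rmorphB modC_real distrC.
Qed.

Lemma near_modC_lt z (r : R) : modC z < r -> \forall w \near z, modC w < r.
Proof. by move=> zr; exact: (@cvgr_lt _ _ _ _ (@modC R) _ (@continuous_modC z) _ zr). Qed.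

Lemma continuous_Complex (T : topologicalType) (u v : T -> R) t :
  {for t, continuous u} -> {for t, continuous v} ->
  {for t, continuous (fun s => u s +i* v s)}.
Proof.
move=> cu cv; rewrite (_ : (fun s => _) = fun s => (u s)%:C + 'i * (v s)%:C).
  apply: cvgD; first exact: (continuous_comp cu (@continuous_real_complex _)).
  apply: cvgM; first exact: cvg_cst.
  exact: (continuous_comp cv (@continuous_real_complex _)).
by apply/funext => s; rewrite [LHS]complexE.
Qed.

End PlaneTopology.

(** * Derivatives *)

Section Slope.
Local Open Scope classical_set_scope.
Variable K : numFieldType.
Implicit Types (f g : K -> K) (x y : K).

Definition slope f x y := if y == x then 'D_1 f x else (f y - f x) / (y - x).

Lemma slopexx f x : slope f x x = 'D_1 f x.
Proof. by rewrite /slope eqxx. Qed.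

Lemma slopeE f x y : f y - f x = slope f x y * (y - x).
Proof.
rewrite /slope; case: eqP => [->|/eqP yx]; first by rewrite !subrr mulr0.
by rewrite divfK // subr_eq0.
Qed.

Lemma continuous_slope f x : derivable f x 1 -> {for x, continuous (slope f x)}.
Proof.
move=> fx; apply/continuous_withinNshiftx; rewrite slopexx.
apply: cvg_trans fx; apply: near_eq_cvg; near=> h.
have h0 : h != 0 by near: h; exact: nbhs_dnbhs_neq.
rewrite /slope /= -subr_eq0 addrK (negbTE h0) mulrC.
by rewrite /GRing.scale /= mulr1.
Unshelve. all: by end_near. Qed.

Lemma is_derive_slope f q x :
  (forall y, f y - f x = q y * (y - x)) -> {for x, continuous q} ->
  is_derive x 1 f (q x).
Proof.
move=> fq cq; suff fx : h^-1 *: (f (h *: 1 + x) - f x) @[h --> 0^'] --> q x.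
  by apply: DeriveDef; [apply/cvg_ex; exists (q x)|exact: cvg_lim fx].
have : (q \o shift x) h @[h --> 0^'] --> q x by apply/continuous_withinNshiftx.
apply: cvg_trans; apply: near_eq_cvg; near=> h.
have h0 : h != 0 by near: h; exact: nbhs_dnbhs_neq.
by rewrite fq /= /GRing.scale /= mulr1 addrK mulrCA mulVf ?mulr1.
Unshelve. all: by end_near. Qed.

Lemma is_derive_comp f g x l m :
  is_derive x 1 f l -> is_derive (f x) 1 g m -> is_derive x 1 (g \o f) (m * l).
Proof.
move=> [df <-] [dg <-]; rewrite -!slopexx.
apply: (@is_derive_slope _ (fun y => slope g (f x) (f y) * slope f x y)).
  by move=> y /=; rewrite slopeE slopeE mulrA.
have cf : {for x, continuous f}.
  exact/differentiable_continuous/derivable1_diffP.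
apply: continuousM; last exact: continuous_slope.
by apply: (continuous_comp cf); exact: continuous_slope.
Qed.

Lemma is_derive_div f g x l m : g x != 0 ->
  is_derive x 1 f l -> is_derive x 1 g m ->
  is_derive x 1 (fun y => f y / g y) ((l * g x - f x * m) / g x ^+ 2).
Proof.
move=> gx df dg; have dV : is_derive x 1 (fun y => (g y)^-1) (- m / g x ^+ 2).
  case: dg => dg <-; apply: DeriveDef; first exact: derivableV.
  by rewrite deriveV // /GRing.scale /= mulrC mulrN mulNr.
by apply: is_derive_eq; rewrite /GRing.scale /=; field.
Qed.

Lemma is_derive_unique f x l m : is_derive x 1 f l -> is_derive x 1 f m -> l = m.
Proof. by move=> [_ <-] [_ <-]. Qed.

Lemma is_derive_right_inverse f g y l :
  is_derive (g y) 1 f l -> l != 0 -> {for y, continuous g} ->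
  (\forall x \near y, f (g x) = x) -> is_derive y 1 g l^-1.
Proof.
move=> [df <-] + cg fg; rewrite -slopexx => l0.
pose q x := slope f (g y) (g x).
pose p x := if f (g x) == x then (q x)^-1 else slope g y x.
have pq : \forall x \near y, (q x)^-1 = p x.
  by apply: filterS fg => x fgx; rewrite /p fgx eqxx.
rewrite -[slope f _ _]/(q y) (nbhs_singleton pq); apply: is_derive_slope => [x|].
  rewrite /p; case: eqP => [fgx|_]; last by rewrite slopeE.
  have : x - y = q x * (g x - g y) by rewrite -slopeE fgx (nbhs_singleton fg).
  have [-> /eqP|qx ->] := eqVneq (q x) 0; last by rewrite mulKf.
  by rewrite mul0r subr_eq0 => /eqP ->; rewrite !subrr mulr0.
have : {for y, continuous (fun x => (q x)^-1)}.
  apply: continuousV; first exact: l0.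
  by apply: (continuous_comp cg); exact: continuous_slope.
rewrite /prop_for /continuous_at (nbhs_singleton pq); apply: cvg_trans.
exact: near_eq_cvg pq.
Qed.

End Slope.

(* The library states these rules for an abstract field, whose topology agrees
   with the instance above only after unfolding. *)
Section ComplexCalculus.
Local Open Scope classical_set_scope.
Variable R : realType.

Section Continuity.
Variables (T : topologicalType) (t : T).
Implicit Types f g : T -> R[i].

Lemma CcontinuousB f g : continuous_at t f -> continuous_at t g ->
  continuous_at t (fun s => f s - g s).
Proof. by move=> cf cg; exact: (continuousB cf cg). Qed.

Lemma CcontinuousM f g : continuous_at t f -> continuous_at t g ->
  continuous_at t (fun s => f s * g s).
Proof. by move=> cf cg; exact: (continuousM cf cg). Qed.

Lemma CcontinuousX f n : continuous_at t f ->
  continuous_at t (fun s => f s ^+ n).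
Proof.
move=> cf; elim: n => [|n IHn].
  exact: cst_continuous.
rewrite (_ : (fun s => _) = fun s => f s * f s ^+ n); first exact: CcontinuousM.
by apply/funext => s; rewrite exprS.
Qed.

Lemma CcontinuousV f : f t != 0 -> continuous_at t f ->
  continuous_at t (fun s => (f s)^-1).
Proof. by move=> ft cf; exact: (continuousV ft cf). Qed.

End Continuity.

Implicit Types (f g : R[i] -> R[i]) (z k : R[i]).

Lemma derivable_Ccontinuous f z : derivable f z 1 -> {for z, continuous f}.
Proof. by move=> /derivable1_diffP/differentiable_continuous. Qed.

Lemma CderivableB f g z : derivable f z 1 -> derivable g z 1 ->
  derivable (fun w => f w - g w) z 1.
Proof. by move=> df dg; exact: (derivableB df dg). Qed.

Lemma CderivableM f g z : derivable f z 1 -> derivable g z 1 ->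
  derivable (fun w => f w * g w) z 1.
Proof. by move=> df dg; exact: (derivableM df dg). Qed.

Lemma CderivableX f n z : derivable f z 1 -> derivable (fun w => f w ^+ n) z 1.
Proof.
move=> df; elim: n => [|n IHn].
  by under eq_fun do rewrite expr0; exact: derivable_cst.
by under eq_fun do rewrite exprS; exact: CderivableM.
Qed.

Lemma CderivableV f z : f z != 0 -> derivable f z 1 ->
  derivable (fun w => (f w)^-1) z 1.
Proof. by move=> fz df; exact: (derivableV fz df). Qed.

End ComplexCalculus.

Section Curves.
Local Open Scope classical_set_scope.
Variable R : realType.
Implicit Types (f : R[i] -> R[i]) (phi psi : R -> R[i]) (t : R) (z l m : R[i]).

Lemma is_derive_modC f z l :
  (forall e : R, 0 < e ->
    \forall w \near z, modC (f w - f z - l * (w - z)) <= e * modC (w - z)) ->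
  is_derive z 1 f l.
Proof.
move=> fl; pose q w := if w == z then l else (f w - f z) / (w - z).
rewrite -(_ : q z = l); last by rewrite /q eqxx.
apply: is_derive_slope => [w|].
  rewrite /q; case: eqP => [->|/eqP wz]; first by rewrite !subrr mulr0.
  by rewrite divfK // subr_eq0.
apply/continuous_modCP => e e0; have /fl : 0 < e / 2 by rewrite divr_gt0.
apply: filterS => w; rewrite {2}/q eqxx /q; case: eqP => [_ _|/eqP].
  by rewrite subrr modC0.
rewrite -subr_eq0 => wz.
have -> : f w - f z - l * (w - z) = ((f w - f z) / (w - z) - l) * (w - z).
  by field.
by rewrite modCM ler_pM2r ?modC_gt0 // => /le_lt_trans; apply; lra.
Qed.

Definition is_derive_curve t phi l :=
  is_derive t 1 (fun s => complex.Re (phi s)) (complex.Re l) /\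
  is_derive t 1 (fun s => complex.Im (phi s)) (complex.Im l).

Lemma is_derive_curveP t phi l : is_derive_curve t phi l <->
  exists q, [/\ forall s, phi s - phi t = q s * (s - t)%:C,
                {for t, continuous q} & q t = l].
Proof.
split=> [[]|[q [phiq cq <-]]].
  move=> /is_derive1_caratheodory[qr [rE cr qrt]].
  move=> /is_derive1_caratheodory[qi [iE ci qit]].
  exists (fun s => qr s +i* qi s); split; last by rewrite qrt qit; case: (l).
    by move=> s; apply: complex_ext; rewrite !ReImE ?rE ?iE /=; ring.
  exact: continuous_Complex.
split; apply/is_derive1_caratheodory.
  exists (fun s => complex.Re (q s)); split => //; last first.
    exact: (continuous_comp cq (@continuous_Re _ _)).
  by move=> s; have := congr1 (@complex.Re R) (phiq s); rewrite !ReImE /= => ->; ring.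
exists (fun s => complex.Im (q s)); split => //; last first.
  exact: (continuous_comp cq (@continuous_Im _ _)).
by move=> s; have := congr1 (@complex.Im R) (phiq s); rewrite !ReImE /= => ->; ring.
Qed.

Lemma is_derive_curve_continuous t phi l :
  is_derive_curve t phi l -> {for t, continuous phi}.
Proof.
move=> /is_derive_curveP[q [phiq cq _]].
rewrite (_ : phi = fun s => phi t + q s * (s - t)%:C); last first.
  by apply/funext => s; rewrite -phiq addrC subrK.
apply: continuousD; first exact: cst_continuous.
apply: CcontinuousM; first exact: cq.
apply: (@continuous_comp _ _ _ (fun s => s - t)); last exact: continuous_real_complex.
by apply: continuousB; [exact: cvg_id|exact: cst_continuous].
Qed.

Lemma is_derive_curveB t phi psi l m :
  is_derive_curve t phi l -> is_derive_curve t psi m ->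
  is_derive_curve t (fun s => phi s - psi s) (l - m).
Proof.
move=> [dr di] [er ei]; rewrite /is_derive_curve !ReImE; split.
  by under eq_fun do rewrite !ReImE; exact: is_deriveB.
by under eq_fun do rewrite !ReImE; exact: is_deriveB.
Qed.

Lemma is_derive_curve_comp t phi f l m :
  is_derive (phi t) 1 f l -> is_derive_curve t phi m ->
  is_derive_curve t (fun s => f (phi s)) (l * m).
Proof.
move=> [df <-] dphi; have cphi := is_derive_curve_continuous dphi.
have /is_derive_curveP[q [phiq cq <-]] := dphi; apply/is_derive_curveP.
exists (fun s => slope f (phi t) (phi s) * q s); split.
- by move=> s; rewrite slopeE phiq mulrA.
- apply: CcontinuousM; last exact: cq.
  by apply: (continuous_comp cphi); exact: (continuous_slope df).
- by rewrite slopexx.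
Qed.

Lemma is_derive_curveZ t phi k l : is_derive_curve t phi l ->
  is_derive_curve t (fun s => k * phi s) (k * l).
Proof.
apply: (@is_derive_curve_comp _ _ (fun w => k * w)).
by apply: is_derive_eq; rewrite /GRing.scale /= mulr1.
Qed.

Lemma is_derive_curve_line z t : is_derive_curve t (fun s => z * s%:C) z.
Proof.
rewrite -[X in is_derive_curve _ _ X]mulr1; apply: is_derive_curveZ.
by split; [exact: is_derive_id|exact: is_derive_cst].
Qed.

End Curves.

(** * Integrals along real intervals *)

Section Between.
Variable R : realDomainType.
Implicit Types a b p t : R.

Definition between a b t := Num.min a b <= t <= Num.max a b.

Lemma between_le a b t : a <= b -> between a b t = (a <= t <= b).
Proof. by move=> ab; rewrite /between min_l ?max_r. Qed.

Lemma betweenC a b t : between a b t = between b a t.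
Proof. by rewrite /between minC maxC. Qed.

Lemma betweenl a b : between a b a.
Proof. by rewrite /between ge_min le_max lexx. Qed.

Lemma betweenr a b : between a b b.
Proof. by rewrite betweenC betweenl. Qed.

Lemma between_hull a b p q t :
  between a b p -> between a b q -> between p q t -> between a b t.
Proof.
move=> /andP[ap pb] /andP[aq qb] /andP[pt tq]; apply/andP; split.
  by apply: le_trans pt; rewrite le_min ap aq.
by apply: le_trans tq _; rewrite ge_max pb qb.
Qed.

Lemma between_dist a b t : between a b t -> `|t - a| <= `|b - a|.
Proof.
have [ab|/ltW ba] := leP a b.
  by rewrite between_le // => /andP[? ?]; rewrite !ger0_norm ?subr_ge0 //; lra.
rewrite betweenC between_le // => /andP[? ?].
by rewrite !ler0_norm ?subr_le0 //; lra.
Qed.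

Lemma between_corner p b s t : 0 < s <= 1 -> p != b ->
  between (p + s * (b - p)) b t -> between p b t /\ t != p.
Proof.
move=> /andP[s0 s1]; rewrite neq_lt => /orP[pb|bp].
  have sp : 0 < s * (b - p) by rewrite mulr_gt0 ?subr_gt0.
  have spb : s * (b - p) <= b - p by rewrite ler_piMl ?subr_ge0 ?(ltW pb).
  rewrite !between_le ?(ltW pb) //; last by lra.
  by move=> /andP[? ?]; split; [apply/andP; split|apply/eqP]; lra.
have sp : 0 < s * (p - b) by rewrite mulr_gt0 ?subr_gt0.
have spb : s * (p - b) <= p - b by rewrite ler_piMl ?subr_ge0 ?(ltW bp).
rewrite ![between _ b t]betweenC !between_le ?(ltW bp) //; last by lra.
by move=> /andP[? ?]; split; [apply/andP; split|apply/eqP]; lra.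
Qed.

Lemma between_scale p b s : 0 <= s <= 1 -> between p b (p + s * (b - p)).
Proof.
move=> /andP[s0 s1]; have [pb|/ltW bp] := leP p b.
  have : 0 <= s * (b - p) <= b - p.
    by rewrite mulr_ge0 ?ler_piMl ?subr_ge0.
  by move=> /andP[? ?]; rewrite between_le //; apply/andP; split; lra.
have : 0 <= s * (p - b) <= p - b by rewrite mulr_ge0 ?ler_piMl ?subr_ge0.
by move=> /andP[? ?]; rewrite betweenC between_le //; apply/andP; split; lra.
Qed.

End Between.

Section OrientedIntegral.
Local Open Scope classical_set_scope.
Variable R : realType.
Local Notation mu := (@lebesgue_measure R).
Implicit Types (u v U : R -> R) (a b c x : R).

Definition rint a b u : R :=
  if a <= b then \int[mu]_(t in `[a, b]) u t else - \int[mu]_(t in `[b, a]) u t.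

Lemma continuous_integrable u a b : continuous u ->
  mu.-integrable `[a, b] (EFin \o u).
Proof.
move=> cu; apply: continuous_compact_integrable; first exact: segment_compact.
exact: continuous_subspaceT.
Qed.

Lemma rint_left c a b u : continuous u -> c <= a -> c <= b ->
  rint a b u = \int[mu]_(t in `[c, b]) u t - \int[mu]_(t in `[c, a]) u t.
Proof.
move=> cu; wlog ab : a b / a <= b => [th|ca cb]; last first.
  rewrite /rint ab Rintegral_itvB ?bnd_simp //; last exact: continuous_integrable.
  rewrite Rintegral_itv_obnd_cbnd //.
  apply: integrableS (continuous_integrable a b cu) => //.
  by apply: subset_itvr; rewrite bnd_simp.
have [/th//|ba ca cb] := leP a b.
have := th b a (ltW ba) cb ca; rewrite /rint (ltW ba) leNgt ba /= => ->.
by rewrite opprB.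
Qed.

Lemma rintxx a u : rint a a u = 0.
Proof. by rewrite /rint lexx set_itv1 Rintegral_set1. Qed.

Lemma rint_chasles b a c u : continuous u ->
  rint a c u = rint a b u + rint b c u.
Proof.
move=> cu; pose m := Num.min a (Num.min b c).
have [ma mb mc] : [/\ m <= a, m <= b & m <= c].
  by rewrite /m !ge_min !lexx !orbT.
by rewrite !(@rint_left m) //; ring.
Qed.

Lemma is_derive_rint a x u : continuous u -> is_derive x 1 (rint a ^~ u) (u x).
Proof.
move=> cu; pose m := Num.min a x - 1.
have [ma mx] : m <= a /\ m < x.
  by rewrite /m; split; [rewrite lerBlDr|rewrite ltrBlDr]; case: (leP a x); lra.
have xx1 : x < x + 1 by rewrite ltrDl.
have [dU UE] :=
  continuous_FTC1_closed xx1 (continuous_integrable m (x + 1) cu) mx (cu x).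
pose I y := \int[mu]_(t in `[m, y]) u t.
have dI : is_derive x 1 (fun y => I y - I a) (u x).
  have dI : is_derive x 1 I (u x) by rewrite -UE derive1E; exact: derivableP.
  by rewrite -[u x]subr0; exact: is_deriveB.
apply: near_eq_is_derive dI; near=> y; rewrite (@rint_left m) //.
by apply/ltW; near: y; exact: lt_nbhsr.
Unshelve. all: by end_near. Qed.

Lemma rint_FTC a b u U : continuous u -> (forall x, is_derive x 1 U (u x)) ->
  rint a b u = U b - U a.
Proof.
move=> cu dU; have : rint a b u - U b = rint a a u - U a.
  apply: (@is_derive_0_is_cst _ (fun x => rint a x u - U x)) => x.
  by rewrite -(subrr (u x)); apply: is_deriveB => //; exact: is_derive_rint.
by rewrite rintxx //; lra.
Qed.

Lemma eq_rint a b u v : (forall t, between a b t -> u t = v t) ->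
  rint a b u = rint a b v.
Proof.
rewrite /rint; case: leP => [ab|/ltW ba] uv; last congr (- _).
  by apply: eq_Rintegral => t; rewrite inE /= in_itv -between_le // => /uv.
by apply: eq_Rintegral => t; rewrite inE /= in_itv -between_le // betweenC => /uv.
Qed.

Lemma rint_MVT a b u : continuous u ->
  exists2 x, between a b x & rint a b u = u x * (b - a).
Proof.
move=> cu; wlog ab : a b / a <= b => [th|]; last first.
  have [|//|x] := @MVT_segment R (rint a ^~ u) u a b ab.
  - by move=> x _; exact: is_derive_rint.
  - apply: derivable_within_continuous => x _.
    by have [] := is_derive_rint a x cu.
  by rewrite in_itv /= -between_le // rintxx // subr0; exists x.
have [/th//|/ltW/th[x xab E]] := leP a b; exists x; first by rewrite betweenC.
have := rint_chasles b a a cu; rewrite rintxx // E => /esym/eqP.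
by rewrite addr_eq0 -mulrN opprB => /eqP.
Qed.

End OrientedIntegral.

Section ComplexIntegral.
Variable R : realType.
Implicit Types (a b : R) (phi psi : R -> R[i]) (k : R[i]).

Definition cint a b phi : R[i] :=
  rint a b (fun t => complex.Re (phi t)) +i* rint a b (fun t => complex.Im (phi t)).

Lemma continuous_Re_curve phi : continuous phi ->
  continuous (fun t => complex.Re (phi t)).
Proof. by move=> cphi t; exact: (continuous_comp (cphi t) (@continuous_Re _ _)). Qed.

Lemma continuous_Im_curve phi : continuous phi ->
  continuous (fun t => complex.Im (phi t)).
Proof. by move=> cphi t; exact: (continuous_comp (cphi t) (@continuous_Im _ _)). Qed.

Lemma is_derive_cint a t phi : continuous phi ->
  is_derive_curve t (fun b => cint a b phi) (phi t).
Proof.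
move=> cphi; split; apply: is_derive_rint.
  exact: continuous_Re_curve.
exact: continuous_Im_curve.
Qed.

Lemma cint_FTC a b phi Phi : continuous phi ->
  (forall t, is_derive_curve t Phi (phi t)) -> cint a b phi = Phi b - Phi a.
Proof.
move=> cphi dPhi; apply: complex_ext; rewrite !ReImE /=.
  apply: (@rint_FTC _ _ _ _ (fun t => complex.Re (Phi t))) => [|t].
    exact: continuous_Re_curve.
  by case: (dPhi t).
apply: (@rint_FTC _ _ _ _ (fun t => complex.Im (Phi t))) => [|t].
  exact: continuous_Im_curve.
by case: (dPhi t).
Qed.

Lemma eq_cint a b phi psi : (forall t, between a b t -> phi t = psi t) ->
  cint a b phi = cint a b psi.
Proof. by move=> E; congr (_ +i* _); apply: eq_rint => t /E ->. Qed.

Lemma cintxx a phi : cint a a phi = 0.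
Proof. by rewrite /cint !rintxx. Qed.

Lemma cint_chasles b a c phi : continuous phi ->
  cint a c phi = cint a b phi + cint b c phi.
Proof.
move=> cphi; apply: complex_ext; rewrite !ReImE /=; apply: rint_chasles.
  exact: continuous_Re_curve.
exact: continuous_Im_curve.
Qed.

Lemma cintB a b phi psi : continuous phi -> continuous psi ->
  cint a b (fun t => phi t - psi t) = cint a b phi - cint a b psi.
Proof.
move=> cphi cpsi.
rewrite (@cint_FTC _ _ _ (fun t => cint a t phi - cint a t psi)).
- by rewrite !cintxx // !subr0.
- by move=> t; apply: CcontinuousB; [exact: cphi|exact: cpsi].
- by move=> t; apply: is_derive_curveB; exact: is_derive_cint.
Qed.

Lemma cintZ a b phi k : continuous phi ->
  cint a b (fun t => k * phi t) = k * cint a b phi.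
Proof.
move=> cphi; rewrite (@cint_FTC _ _ _ (fun t => k * cint a t phi)).
- by rewrite cintxx // mulr0 subr0.
- by move=> t; apply: CcontinuousM; [exact: cst_continuous|exact: cphi].
- by move=> t; apply: is_derive_curveZ; exact: is_derive_cint.
Qed.

Lemma cint_cst a b k : cint a b (fun=> k) = k * (b - a)%:C.
Proof.
rewrite (@cint_FTC _ _ _ (fun t => k * t%:C)).
- by rewrite -mulrBr -rmorphB.
- by move=> t; exact: cst_continuous.
- by move=> t; exact: is_derive_curve_line.
Qed.

(* Rotate the integral onto the positive real axis. *)
Lemma cint_bound a b phi (M : R) : continuous phi ->
  (forall t, between a b t -> modC (phi t) <= M) ->
  modC (cint a b phi) <= M * `|b - a|.
Proof.
move=> cphi phiM; set I := cint a b phi.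
have [k k1 kI] : exists2 k, modC k = 1 & k * I = (modC I)%:C.
  have [->|I0] := eqVneq I 0; first by exists 1; rewrite ?modC0 ?mulr0 ?modC1.
  exists ((modC I)%:C / I); last by rewrite divfK.
  by rewrite modCM modCV modC_real ger0_norm ?modC_ge0 // divff // modC_eq0.
have ck : continuous (fun t => k * phi t).
  by move=> t; apply: CcontinuousM; [exact: cst_continuous|exact: cphi].
have [t tab E] := rint_MVT a b (continuous_Re_curve ck).
have -> : modC I = complex.Re (cint a b (fun t => k * phi t)) by rewrite cintZ // kI.
rewrite /= {}E (le_trans (ler_norm _)) // normrM ler_wpM2r //.
by rewrite (le_trans (Re_le_modC _)) // modCM k1 mul1r phiM.
Qed.

End ComplexIntegral.

(** * Goursat's theorem *)

Section Quadrisection.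
Local Open Scope classical_set_scope.
Variable R : realType.

Lemma nested_intervals (a b : nat -> R) :
  nondecreasing_seq a -> nonincreasing_seq b -> (forall n, a n <= b n) ->
  exists x, forall n, a n <= x <= b n.
Proof.
move=> a_incr b_decr ab; have amn m n : a m <= b n.
  apply: (le_trans (a_incr _ _ (leq_maxl m n))); apply: (le_trans (ab _)).
  exact: b_decr (leq_maxr m n).
exists (sup (range a)) => n; apply/andP; split.
  by apply: ub_le_sup; [exists (b 0%N) => _ [m _ <-]|exists n].
by apply: ge_sup; [exists (a 0%N), 0%N|move=> _ [m _ <-]].
Qed.

Lemma ex_half_pow_lt (W e : R) : 0 < e -> exists n, W / 2 ^+ n < e.
Proof.
move=> e0; have half1 : `|2^-1 : R| < 1 by rewrite gtr0_norm ?invf_lt1; lra.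
have [n _ /(_ n (leqnn n))] := @cvgr_lt _ _ _ _ _ _ (cvg_geometric W half1) _ e0.
by rewrite /= exprVn; exists n.
Qed.

Variable P : R -> R -> R -> R -> Prop.
Hypothesis P_quarters : forall a b c d, a <= b -> c <= d ->
  let m := (a + b) / 2 in let n := (c + d) / 2 in
  P a m c n -> P m b c n -> P a m n d -> P m b n d -> P a b c d.

Let left (q : R * R * R * R) := q.1.1.1.
Let right (q : R * R * R * R) := q.1.1.2.
Let bottom (q : R * R * R * R) := q.1.2.
Let top (q : R * R * R * R) := q.2.

Let bad q := [/\ left q <= right q, bottom q <= top q
  & ~ P (left q) (right q) (bottom q) (top q)].

Let half q q' :=
  [/\ left q <= left q', right q' <= right q
    & right q' - left q' = (right q - left q) / 2] /\
  [/\ bottom q <= bottom q', top q' <= top q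
    & top q' - bottom q' = (top q - bottom q) / 2].

Let ex_bad_half q : bad q -> exists q', bad q' /\ half q q'.
Proof.
case: q => [[[a b] c] d] []; rewrite /left /right /bottom /top /= => ab cd NP.
apply: contrapT => no; apply: NP; apply: P_quarters => //; apply: contrapT => NP.
- apply: no; exists (a, (a + b) / 2, c, (c + d) / 2).
  by rewrite /bad /half /left /right /bottom /top /=; do !split=> //; lra.
- apply: no; exists ((a + b) / 2, b, c, (c + d) / 2).
  by rewrite /bad /half /left /right /bottom /top /=; do !split=> //; lra.
- apply: no; exists (a, (a + b) / 2, (c + d) / 2, d).
  by rewrite /bad /half /left /right /bottom /top /=; do !split=> //; lra.
- apply: no; exists ((a + b) / 2, b, (c + d) / 2, d).
  by rewrite /bad /half /left /right /bottom /top /=; do !split=> //; lra.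
Qed.

Lemma quadrisection a b c d : a <= b -> c <= d ->
  (forall x y, a <= x <= b -> c <= y <= d -> exists2 e, 0 < e &
    forall a' b' c' d', a' <= x <= b' -> c' <= y <= d' ->
      (b' - a') + (d' - c') < e -> P a' b' c' d') ->
  P a b c d.
Proof.
move=> ab cd P_local; apply: contrapT => NP.
have /choice[next nextP] q : exists q', bad q -> bad q' /\ half q q'.
  have [/ex_bad_half[q' ?]|?] := pselect (bad q); first by exists q'.
  by exists q.
pose q n := iter n next (a, b, c, d).
have bad_q n : bad (q n) by elim: n => [//|n /nextP[]].
have half_q n : half (q n) (q n.+1) by have [] := nextP _ (bad_q n).
have width n : right (q n) - left (q n) = (b - a) / 2 ^+ n /\
               top (q n) - bottom (q n) = (d - c) / 2 ^+ n.
  elim: n => [|n [IHx IHy]]; first by rewrite expr0 !divr1.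
  have [[_ _ ->] [_ _ ->]] := half_q n; rewrite IHx IHy exprS.
  by split; field; rewrite expf_neq0.
have [x xq] : exists x, forall n, left (q n) <= x <= right (q n).
  apply: nested_intervals => [||n]; last by case: (bad_q n).
    by apply/nondecreasing_seqP => n; have [[]] := half_q n.
  by apply/nonincreasing_seqP => n; have [[]] := half_q n.
have [y yq] : exists y, forall n, bottom (q n) <= y <= top (q n).
  apply: nested_intervals => [||n]; last by case: (bad_q n).
    by apply/nondecreasing_seqP => n; have [_ []] := half_q n.
  by apply/nonincreasing_seqP => n; have [_ []] := half_q n.
have [e e0 eP] := P_local x y (xq 0%N) (yq 0%N).
have [n small] := ex_half_pow_lt ((b - a) + (d - c)) e0.
have [_ _] := bad_q n; apply; apply: eP => //.
by have [-> ->] := width n; rewrite -mulrDl.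
Qed.

End Quadrisection.

Section Rectangle.
Local Open Scope classical_set_scope.
Variable R : realType.
Implicit Types (f g F : R[i] -> R[i]) (a b c d m n x y : R) (z w : R[i]).

Definition hor f y a b : R[i] := cint a b (fun t => f (t +i* y)).
Definition ver f x c d : R[i] := cint c d (fun s => f (x +i* s)).
Definition rect f a b c d : R[i] :=
  hor f c a b + 'i * ver f b c d - hor f d a b - 'i * ver f a c d.

Definition box a b c d : set R[i] :=
  [set z | between a b (complex.Re z) /\ between c d (complex.Im z)].

Lemma compact_box a b c d : compact (box a b c d).
Proof.
have -> : box a b c d = (fun p : R * R => p.1 +i* p.2) @`
    (`[Num.min a b, Num.max a b] `*` `[Num.min c d, Num.max c d]).
  apply/seteqP; split=> [[x y] [xab ycd]|_ [[x y] [/= xab ycd] <-]].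
    by exists (x, y); rewrite //= !in_itv.
  by rewrite !in_itv in xab ycd.
apply: continuous_compact; last by apply: compact_setX; exact: segment_compact.
apply: continuous_subspaceT => p.
by apply: continuous_Complex; [exact: cvg_fst|exact: cvg_snd].
Qed.

Lemma continuous_hor f y : continuous f -> continuous (fun t => f (t +i* y)).
Proof.
move=> cf t; apply: (@continuous_comp _ _ _ (fun t => t +i* y)); last exact: cf.
by apply: continuous_Complex; [exact: cvg_id|exact: cst_continuous].
Qed.

Lemma continuous_ver f x : continuous f -> continuous (fun s => f (x +i* s)).
Proof.
move=> cf s; apply: (@continuous_comp _ _ _ (fun s => x +i* s)); last exact: cf.
by apply: continuous_Complex; [exact: cst_continuous|exact: cvg_id].
Qed.

Lemma rectB f g a b c d : continuous f -> continuous g ->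
  rect (fun z => f z - g z) a b c d = rect f a b c d - rect g a b c d.
Proof.
move=> cf cg; rewrite /rect /hor /ver !cintB; first by ring.
all: by [exact: continuous_hor|exact: continuous_ver].
Qed.

Lemma rect_splitx m f a b c d : continuous f ->
  rect f a b c d = rect f a m c d + rect f m b c d.
Proof.
move=> cf; rewrite /rect /hor !(@cint_chasles _ m a b); first by ring.
all: exact: continuous_hor.
Qed.

Lemma rect_splity n f a b c d : continuous f ->
  rect f a b c d = rect f a b c n + rect f a b n d.
Proof.
move=> cf; rewrite /rect /ver !(@cint_chasles _ n c d); first by ring.
all: exact: continuous_ver.
Qed.

Lemma rect_quad m n f a b c d : continuous f -> rect f a b c d =
  rect f a m c n + rect f m b c n + rect f a m n d + rect f m b n d.
Proof.
move=> cf; rewrite (rect_splity n) // (rect_splitx m) //.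
by rewrite [rect f a b n d](rect_splitx m) // !addrA.
Qed.

Lemma rectxx f a c d : rect f a a c d = 0.
Proof. by rewrite /rect /hor !cintxx; ring. Qed.

Lemma rectyy f a b c : rect f a b c c = 0.
Proof. by rewrite /rect /ver !cintxx; ring. Qed.

Lemma rectNx f a b c d : continuous f -> rect f b a c d = - rect f a b c d.
Proof. by move=> cf; apply/eqP; rewrite -addr_eq0 -rect_splitx // rectxx. Qed.

Lemma rectNy f a b c d : continuous f -> rect f a b d c = - rect f a b c d.
Proof. by move=> cf; apply/eqP; rewrite -addr_eq0 -rect_splity // rectyy. Qed.

Lemma hor_primitive f F y a b : continuous f -> (forall z, is_derive z 1 F (f z)) ->
  hor f y a b = F (b +i* y) - F (a +i* y).
Proof.
move=> cf dF; rewrite /hor (@cint_FTC _ _ _ _ (fun t => F (t +i* y))) //.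
  exact: continuous_hor.
move=> t; rewrite -[f _]mulr1; apply: (@is_derive_curve_comp _ _ (fun t => t +i* y)).
by split; [exact: is_derive_id|exact: is_derive_cst].
Qed.

Lemma ver_primitive f F x c d : continuous f -> (forall z, is_derive z 1 F (f z)) ->
  'i * ver f x c d = F (x +i* d) - F (x +i* c).
Proof.
move=> cf dF; rewrite /ver -cintZ; last exact: continuous_ver.
rewrite (@cint_FTC _ _ _ _ (fun t => F (x +i* t))) // => t.
  by apply: CcontinuousM; [exact: cst_continuous|exact: continuous_ver].
rewrite mulrC; apply: (@is_derive_curve_comp _ _ (fun t => x +i* t)).
by split; [exact: is_derive_cst|exact: is_derive_id].
Qed.

Lemma rect_primitive f F a b c d : continuous f ->
  (forall z, is_derive z 1 F (f z)) -> rect f a b c d = 0.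
Proof.
move=> cf dF.
by rewrite /rect !(hor_primitive _ _ _ cf dF) !(ver_primitive _ _ _ cf dF); ring.
Qed.

Lemma continuous_affine (k l z0 : R[i]) : continuous (fun z => k + l * (z - z0)).
Proof.
move=> z; apply: derivable_Ccontinuous.
have : is_derive z 1 (fun w => k + l * (w - z0)) l.
  by apply: is_derive_eq; rewrite /GRing.scale /=; ring.
by case.
Qed.

Lemma rect_affine a b c d (k l z0 : R[i]) :
  rect (fun z => k + l * (z - z0)) a b c d = 0.
Proof.
have dF z : is_derive z 1 (fun w => k * w + l / 2 * (w - z0) ^+ 2) (k + l * (z - z0)).
  by apply: is_derive_eq; rewrite /GRing.scale /=; field.
by apply: rect_primitive dF; exact: continuous_affine.
Qed.

Lemma rect_bound f a b c d (M : R) : continuous f ->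
  (forall z, box a b c d z -> modC (f z) <= M) ->
  modC (rect f a b c d) <= 2 * M * (`|b - a| + `|d - c|).
Proof.
move=> cf fM.
have hM y : between c d y -> modC (hor f y a b) <= M * `|b - a|.
  by move=> ycd; apply: cint_bound => [|t tab]; [exact: continuous_hor|exact: fM].
have vM x : between a b x -> modC ('i * ver f x c d) <= M * `|d - c|.
  move=> xab; rewrite modCM modCi mul1r.
  by apply: cint_bound => [|t tcd]; [exact: continuous_ver|exact: fM].
have := hM c (betweenl c d); have := hM d (betweenr c d).
have := vM a (betweenl a b); have := vM b (betweenr a b).
rewrite /rect; set q := 'i * ver f b c d; set s := 'i * ver f a c d.
set p := hor f c a b; set r := hor f d a b.
by have := modCB (p + q - r) s; have := modCB (p + q) r; have := modCD p q; lra.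
Qed.

Lemma rect_small f z0 (e : R) : continuous f -> derivable f z0 1 -> 0 < e ->
  exists2 dl, 0 < dl & forall a b c d,
    a <= complex.Re z0 <= b -> c <= complex.Im z0 <= d ->
    (b - a) + (d - c) < dl ->
    modC (rect f a b c d) <= e * ((b - a) + (d - c)) ^+ 2.
Proof.
move=> cf df e0; have e2 : 0 < e / 2 by rewrite divr_gt0.
have /continuous_modCP/(_ _ e2)/nbhs_modCP[dl dl0 slope_dl] := continuous_slope df.
exists dl => // a b c d /andP[a0 b0] /andP[c0 d0]; set W := b - a + (d - c) => Wdl.
have ab : a <= b by lra. have cd : c <= d by lra.
pose l : R[i] := slope f z0 z0.
have cg := @continuous_affine (f z0) l z0.
rewrite -[rect f a b c d]subr0 -(rect_affine a b c d (f z0) l z0) -(rectB _ _ _ _ cf cg).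
rewrite (_ : e * W ^+ 2 = 2 * (e / 2 * W) * (`|b - a| + `|d - c|)); last first.
  by rewrite !ger0_norm ?subr_ge0 // -/W; field.
apply: rect_bound => [z|z [zx zy]].
  exact: (CcontinuousB (cf z) (cg z)).
have zW : modC (z - z0) <= W.
  move: zx zy; rewrite !between_le // => /andP[? ?] /andP[? ?].
  rewrite (le_trans (modC_le_ReIm _)) // !ReImE lerD // ler_norml.
    by apply/andP; split; lra.
  by apply/andP; split; lra.
have -> : f z - (f z0 + l * (z - z0)) = (slope f z0 z - l) * (z - z0).
  by rewrite opprD addrA slopeE mulrBl.
rewrite modCM ler_pM ?modC_ge0 //.
by apply: ltW; apply: slope_dl; exact: le_lt_trans Wdl.
Qed.

(* The square of the half-perimeter, unlike the area, dominates the estimate of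
   [rect_small], and quadrisection still divides it exactly by four. *)
Lemma goursat_le f a b c d : continuous f -> a <= b -> c <= d ->
  (forall z, box a b c d z -> derivable f z 1) -> rect f a b c d = 0.
Proof.
move=> cf ab cd df; apply: (@modC_eq0_eps _ _ (((b - a) + (d - c)) ^+ 2)) => e /andP[e0 _].
pose P a b c d := modC (rect f a b c d) <= e * ((b - a) + (d - c)) ^+ 2.
apply: (@quadrisection _ P) => // [{df}{}a {}b {}c {}d {}ab {}cd m n|x y xab ycd].
  rewrite /P => Pll Plr Pul Pur; rewrite (rect_quad m n) //.
  set W := b - a + (d - c) in Pll Plr Pul Pur *.
  have quarter u v : u + v = W / 2 -> e * (u + v) ^+ 2 = e * W ^+ 2 / 4.
    by move=> ->; field.
  rewrite quarter in Pll; last by rewrite /W /m /n; field.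
  rewrite quarter in Plr; last by rewrite /W /m /n; field.
  rewrite quarter in Pul; last by rewrite /W /m /n; field.
  rewrite quarter in Pur; last by rewrite /W /m /n; field.
  rewrite (_ : e * W ^+ 2 = e * W ^+ 2 / 4 + e * W ^+ 2 / 4 + e * W ^+ 2 / 4 +
    e * W ^+ 2 / 4); last by field.
  have Pl := le_trans (modCD _ _) (lerD Pll Plr).
  have Plul := le_trans (modCD _ _) (lerD Pl Pul).
  exact: le_trans (modCD _ _) (lerD Plul Pur).
have dxy : derivable f (x +i* y) 1 by apply: df; split; rewrite /= between_le.
exact: rect_small dxy e0.
Qed.

Lemma goursat f a b c d : continuous f ->
  (forall z, box a b c d z -> derivable f z 1) -> rect f a b c d = 0.
Proof.
move=> cf; wlog ab : a b / a <= b => [th|].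
  have [/th//|/ltW/th ba] := leP a b => df; rewrite rectNx // ba ?oppr0 // => z [zx zy].
  by apply: df; split=> //; rewrite betweenC.
wlog cd : c d / c <= d => [th|]; last exact: goursat_le.
have [/th//|/ltW/th dc] := leP c d => df; rewrite rectNy // dc ?oppr0 // => z [zx zy].
by apply: df; split=> //; rewrite betweenC.
Qed.

(* Shrinking the rectangle towards the corner does not change the integral,
   which is at most proportional to the perimeter. *)
Lemma goursat_corner f p b q d : continuous f ->
  (forall z, box p b q d z -> z != p +i* q -> derivable f z 1) ->
  rect f p b q d = 0.
Proof.
move=> cf df; have [M fM] : exists M : R, forall z, box p b q d z -> modC (f z) <= M.
  have [] := @compact_EVT_max _ R (fun z => modC (f z)) (box p b q d).
  - by exists (p +i* q); split; exact: betweenl.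
  - exact: compact_box.
  - apply: continuous_subspaceT => z.
    exact: (continuous_comp (cf z) (@continuous_modC _ _)).
  by move=> z0 _ fz0; exists (modC (f z0)) => z zb; apply: fz0; rewrite inE.
apply: (@modC_eq0_eps _ _ (2 * M * (`|b - p| + `|d - q|))) => s s01.
have [s0 s1] := andP s01; have s01' : 0 <= s <= 1 by rewrite ltW.
pose x := p + s * (b - p); pose y := q + s * (d - q).
have xpb : between p b x by exact: between_scale.
have yqd : between q d y by exact: between_scale.
have -> : rect f p b q d = rect f p x q y.
  rewrite (rect_splitx x) // (rect_splity y p x) //.
  have -> : rect f x b q d = 0.
    have [pb|pb] := eqVneq p b; first by rewrite /x pb subrr mulr0 addr0 rectxx.
    apply: goursat => // z [zx zy]; have [zpb zp] := between_corner s01 pb zx.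
    by apply: df => //; apply: contraNneq zp => ->.
  have -> : rect f p x y d = 0.
    have [qd|qd] := eqVneq q d; first by rewrite /y qd subrr mulr0 addr0 rectyy.
    apply: goursat => // z [zx zy]; have [zqd zq] := between_corner s01 qd zy.
    apply: df; last by apply: contraNneq zq => ->.
    by split=> //; apply: between_hull zx => //; exact: betweenl.
  by rewrite !addr0.
have -> : s * (2 * M * (`|b - p| + `|d - q|)) = 2 * M * (`|x - p| + `|y - q|).
  by rewrite /x /y ![_ + _ * _]addrC !addrK !normrM gtr0_norm //; ring.
apply: rect_bound => // z [zx zy]; apply: fM.
by split; [apply: between_hull zx|apply: between_hull zy]; rewrite ?betweenl.
Qed.

Lemma goursat_except f z0 a b c d : continuous f ->
  (forall z, box a b c d z -> z != z0 -> derivable f z 1) ->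
  rect f a b c d = 0.
Proof.
case: z0 => p q cf df.
have [[/= pab qcd]|out] := pselect (box a b c d (p +i* q)); last first.
  apply: goursat => // z zb; apply: df => //.
  by apply: contra_not_neq out => <-.
have corner x y : between a b x -> between c d y -> rect f p x q y = 0.
  move=> xab ycd; apply: goursat_corner => // z [zx zy] zpq.
  by apply: df => //; split; [exact: between_hull zx|exact: between_hull zy].
rewrite (rect_quad p q) // [rect f a p c q]rectNx // [rect f p a c q]rectNy //.
rewrite [rect f p b c q]rectNy // [rect f a p q d]rectNx //.
by rewrite !corner ?betweenl ?betweenr // !oppr0 !addr0.
Qed.

End Rectangle.

(** * Primitives on a disk *)

Section Holomorphic.
Local Open Scope classical_set_scope.
Variable R : realType.
Implicit Types (f g : R[i] -> R[i]) (z w u : R[i]) (r rho : R).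

Definition holomorphic r f := forall z, modC z < r -> derivable f z 1.

Lemma holomorphic_continuous r f z :
  holomorphic r f -> modC z < r -> {for z, continuous f}.
Proof. by move=> df zr; exact/derivable_Ccontinuous/df. Qed.

Lemma holomorphic_is_derive r f z :
  holomorphic r f -> modC z < r -> is_derive z 1 f (cderiv f z).
Proof. by move=> df zr; exact/derivableP/df. Qed.

Lemma eq_holomorphic r f g : (forall z, modC z < r -> f z = g z) ->
  holomorphic r f -> holomorphic r g.
Proof.
move=> fg df z zr; apply: near_eq_derivable (df z zr).
by apply: filterS (near_modC_lt zr) => w /fg.
Qed.

Lemma is_derive_holomorphic r f (df : R[i] -> R[i]) :
  (forall z, modC z < r -> is_derive z 1 f (df z)) -> holomorphic r f.
Proof. by move=> fdf z /fdf[]. Qed.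

Lemma ex_radius z rho : modC z < rho -> exists r, [/\ 0 < r, modC z < r & r < rho].
Proof.
move=> zrho; have z0 := modC_ge0 z.
by exists ((modC z + rho) / 2); split; lra.
Qed.

Lemma disk_cst r f : (forall z, modC z < r -> is_derive z 1 f 0) ->
  forall z, modC z < r -> f z = f 0.
Proof.
move=> df z zr; have dfz (t : R) :
    0 <= t <= 1 -> is_derive_curve t (fun s => f (z * s%:C)) 0.
  move=> /andP[t0 t1]; rewrite -(mul0r z).
  apply: (@is_derive_curve_comp _ _ (fun s => z * s%:C)); last exact: is_derive_curve_line.
  apply: df; rewrite modCM modC_real ger0_norm //; apply: le_lt_trans zr.
  by rewrite ler_piMr ?modC_ge0.
have real_cst (v : R -> R) :
    (forall t : R, 0 <= t <= 1 -> is_derive t 1 v 0) -> v 1 = v 0.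
  move=> dv; have [| |t _] := @MVT_segment R v (fun=> 0) 0 1 ler01.
  - by move=> t; rewrite in_itv /= => /andP[? ?]; apply: dv; rewrite !ltW.
  - apply: derivable_within_continuous => t; rewrite in_itv /= => /dv dvt.
    by have [] := dvt.
  by rewrite mul0r => /eqP; rewrite subr_eq0 => /eqP.
rewrite -[z in LHS]mulr1 -[0 in RHS](mulr0 z); apply: complex_ext.
  by apply: (@real_cst (fun s => complex.Re (f (z * s%:C)))) => t /dfz[].
by apply: (@real_cst (fun s => complex.Im (f (z * s%:C)))) => t /dfz[].
Qed.

Definition elbow f z w : R[i] :=
  hor f (complex.Im z) (complex.Re z) (complex.Re w) +
  'i * ver f (complex.Re w) (complex.Im z) (complex.Im w).

Definition primitive f := elbow f 0.

Lemma primitive0 f : primitive f 0 = 0.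
Proof. by rewrite /primitive /elbow /hor /ver !cintxx mulr0 addr0. Qed.

Lemma primitiveB f z w : continuous f ->
  rect f (complex.Re z) (complex.Re w) 0 (complex.Im z) = 0 ->
  primitive f w - primitive f z = elbow f z w.
Proof.
move=> cf; rewrite /primitive /elbow /rect /hor /ver /=.
rewrite (cint_chasles (complex.Re z) 0 (complex.Re w)); last exact: continuous_hor.
rewrite (cint_chasles (complex.Im z) 0 (complex.Im w)); last exact: continuous_ver.
by move=> rect0; rewrite -[RHS]addr0 -[X in _ = _ + X]rect0; ring.
Qed.

Lemma elbowB f g z w : continuous f -> continuous g ->
  elbow (fun u => f u - g u) z w = elbow f z w - elbow g z w.
Proof.
move=> cf cg; rewrite /elbow /hor /ver !cintB; first by ring.
all: by [exact: continuous_hor|exact: continuous_ver].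
Qed.

Lemma elbow_cst k z w : elbow (fun=> k) z w = k * (w - z).
Proof.
rewrite /elbow /hor /ver !cint_cst mulrCA -mulrDr; congr (_ * _).
by apply: complex_ext; rewrite !ReImE /=; ring.
Qed.

Lemma elbow_bound f z w (M : R) : continuous f ->
  (forall u, modC (u - z) <= modC (w - z) -> modC (f u) <= M) ->
  modC (elbow f z w) <= 2 * M * modC (w - z).
Proof.
move=> cf fM; have M0 : 0 <= M.
  by apply: le_trans (fM z _); rewrite ?modC_ge0 // subrr modC0 modC_ge0.
have hM : modC (hor f (complex.Im z) (complex.Re z) (complex.Re w)) <= M * modC (w - z).
  apply: (@le_trans _ _ (M * `|complex.Re w - complex.Re z|)).
    apply: cint_bound => [|t tzw]; first exact: continuous_hor.
    apply: fM; apply: le_modC; rewrite !ReImE /=; first exact: between_dist.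
    by rewrite subrr normr0.
  by rewrite ler_wpM2l // -Re_opp -Re_add Re_le_modC.
have vM :
    modC ('i * ver f (complex.Re w) (complex.Im z) (complex.Im w)) <= M * modC (w - z).
  rewrite modCM modCi mul1r; apply: (@le_trans _ _ (M * `|complex.Im w - complex.Im z|)).
    apply: cint_bound => [|t tzw]; first exact: continuous_ver.
    by apply: fM; apply: le_modC; rewrite !ReImE //=; exact: between_dist.
  by rewrite ler_wpM2l // -Im_opp -Im_add Im_le_modC.
by rewrite (le_trans (modCD _ _)) // -mulrA mulr2n mulrDl mul1r lerD.
Qed.

Lemma is_derive_primitive_continuous f z : continuous f ->
  (\forall w \near z, rect f (complex.Re z) (complex.Re w) 0 (complex.Im z) = 0) ->
  is_derive z 1 (primitive f) (f z).
Proof.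
move=> cf rect0; apply: is_derive_modC => e e0; have e2 : 0 < e / 2 by rewrite divr_gt0.
have /continuous_modCP/(_ _ e2)/nbhs_modCP[d d0 fd] := cf z.
have wd : \forall w \near z, modC (w - z) < d by apply/nbhs_modCP; exists d.
apply: filterS2 rect0 wd => w rect0 wd.
have cz : continuous (fun _ : R[i] => f z) by move=> u; exact: cst_continuous.
rewrite primitiveB // -elbow_cst -(elbowB _ _ cf cz).
rewrite (_ : e = 2 * (e / 2)); last by field.
apply: elbow_bound => [u|u uw].
  exact: (CcontinuousB (cf u) (cz u)).
by apply/ltW/fd; exact: le_lt_trans wd.
Qed.

Lemma eq_primitive f g w : (forall u, modC u <= modC w -> f u = g u) ->
  primitive f w = primitive g w.
Proof.
move=> fg; rewrite /primitive /elbow /hor /ver /=; congr (_ + 'i * _).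
  apply: eq_cint => t /between_dist; rewrite !subr0 => tw; apply: fg.
  by apply: le_modC; rewrite //= normr0.
apply: eq_cint => t /between_dist; rewrite !subr0 => tw; apply: fg.
exact: le_modC.
Qed.

Definition retract r z : R[i] := z * (r / Num.max r (modC z))%:C.

Lemma retract_id r z : 0 < r -> modC z <= r -> retract r z = z.
Proof. by move=> r0 zr; rewrite /retract max_l // divff ?gt_eqF // mulr1. Qed.

Lemma modC_retract r z : 0 < r -> modC (retract r z) <= r.
Proof.
move=> r0; have m0 : 0 < Num.max r (modC z) by rewrite lt_max r0.
rewrite /retract modCM modC_real ger0_norm; last by rewrite divr_ge0 // ltW.
by rewrite mulrCA ler_piMr ?(ltW r0) // ler_pdivrMr // mul1r le_max lexx orbT.
Qed.

Lemma continuous_retract r : 0 < r -> continuous (retract r).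
Proof.
move=> r0 z; have cm : {for z, continuous (fun w => r / Num.max r (modC w))}.
  apply: continuousM; first exact: cst_continuous.
  apply: continuousV; first by rewrite gt_eqF // lt_max r0.
  by apply: continuous_max; [exact: cst_continuous|exact: continuous_modC].
have cid : {for z, continuous (fun w : R[i] => w)} by exact: cvg_id.
exact: (CcontinuousM cid (continuous_comp cm (@continuous_real_complex _ _))).
Qed.

(* Composing with the retraction onto a smaller disk makes [f] continuous on
   the whole plane without changing its primitive. *)
Theorem is_derive_primitive f z0 rho :
  (forall z, modC z < rho -> {for z, continuous f}) ->
  (forall z, modC z < rho -> z != z0 -> derivable f z 1) ->
  forall z, modC z < rho -> is_derive z 1 (primitive f) (f z).
Proof.
move=> cf df z zrho; have [r [r0 zr rrho]] := ex_radius zrho.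
pose fr w := f (retract r w).
have cfr : continuous fr.
  move=> w; apply: (@continuous_comp _ _ _ (retract r)); first exact: continuous_retract.
  by apply: cf; exact: le_lt_trans (modC_retract w r0) rrho.
have frE w : modC w < r -> fr w = f w by move=> /ltW wr; rewrite /fr retract_id.
have dfr w : modC w < r -> w != z0 -> derivable fr w 1.
  move=> wr w0; apply: near_eq_derivable (df w (lt_trans wr rrho) w0).
  by apply: filterS (near_modC_lt wr) => u ur; rewrite frE.
have : is_derive z 1 (primitive fr) (f z).
  rewrite -frE //; apply: is_derive_primitive_continuous; first exact: cfr.
  have : \forall w \near z, modC (w - z) < r - modC z.
    by apply/nbhs_modCP; exists (r - modC z); rewrite ?subr_gt0.
  apply: filterS => w wz; apply: (@goursat_except _ _ z0); first exact: cfr.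
  move=> u [uzw u0].
  apply: dfr; apply: (@le_lt_trans _ _ (modC z + modC (w - z))); last by lra.
  rewrite -[u in modC u](subrK (complex.Re z +i* complex.Im u)) addrC.
  rewrite (le_trans (modCD _ _)) // lerD //.
    apply: le_modC => //=.
    by move: (between_dist u0); rewrite !subr0.
  apply: le_modC; rewrite !ReImE /=; first exact: between_dist.
  by rewrite subrr normr0.
apply: near_eq_is_derive; apply: filterS (near_modC_lt zr) => w wr.
by apply: eq_primitive => u uw; rewrite frE // (le_lt_trans uw).
Qed.

End Holomorphic.

(** * Cauchy's formula *)

Section Circle.
Local Open Scope classical_set_scope.
Variable R : realType.
Implicit Types (r t : R) (z : R[i]).

Lemma modC_expi t : modC (expi t) = 1.
Proof. by rewrite /modC /= cos2Dsin2 sqrtr1. Qed.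

Lemma expi0 : expi (0 : R) = 1.
Proof. by rewrite /expi cos0 sin0. Qed.

Lemma expi2pi : expi (pi *+ 2 : R) = 1.
Proof. by rewrite /expi cos2pi sin2pi. Qed.

Lemma is_derive_curve_expi t : is_derive_curve t (@expi R) ('i * expi t).
Proof.
rewrite /is_derive_curve !ReImE /= !mul0r !mul1r sub0r add0r; split.
  exact: is_derive_cos.
exact: is_derive_sin.
Qed.

Definition circle r t : R[i] := r%:C * expi t.

Lemma circle2pi r : circle r (pi *+ 2) = circle r 0.
Proof. by rewrite /circle expi2pi expi0. Qed.

Lemma modC_circle r t : 0 <= r -> modC (circle r t) = r.
Proof. by move=> r0; rewrite modCM modC_expi modC_real ger0_norm ?mulr1. Qed.

Lemma is_derive_curve_circle r t : is_derive_curve t (circle r) ('i * circle r t).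
Proof. by rewrite /circle mulrCA; apply: is_derive_curveZ; exact: is_derive_curve_expi. Qed.

Lemma continuous_circle r : continuous (circle r).
Proof. by move=> t; exact: is_derive_curve_continuous (is_derive_curve_circle r t). Qed.

Lemma ler_circleB r z t : 0 <= r -> r - modC z <= modC (circle r t - z).
Proof. by move=> r0; rewrite -{1}(modC_circle t r0); exact: ler_modCB. Qed.

Lemma circleB_neq0 r z t : modC z < r -> circle r t - z != 0.
Proof.
move=> zr; rewrite -modC_gt0 (lt_le_trans _ (ler_circleB _ _ _)) ?subr_gt0 //.
exact: ltW (le_lt_trans (modC_ge0 z) zr).
Qed.

Lemma pi2_gt0 : 0 < pi *+ 2 :> R.
Proof. by rewrite mulrn_wgt0 // pi_gt0. Qed.

End Circle.

Section ParametricIntegral.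
Local Open Scope classical_set_scope.
Variable R : realType.
Implicit Types (a b : R) (phi : R -> R[i]) (z w x y h : R[i]).

Lemma continuous_bounded_curve a b phi : continuous phi ->
  exists2 M : R, 0 <= M & forall t, between a b t -> modC (phi t) <= M.
Proof.
move=> cphi; wlog ab : a b / a <= b => [th|].
  have [/th//|/ltW/th[M M0 phiM]] := leP a b.
  by exists M => // t; rewrite betweenC => /phiM.
have [|t _ phit] := @EVT_max R (fun t => modC (phi t)) a b ab.
  apply: continuous_subspaceT => t.
  exact: (continuous_comp (cphi t) (@continuous_modC _ _)).
exists (modC (phi t)); first exact: modC_ge0.
by move=> s; rewrite between_le // => sab; apply: phit; rewrite in_itv.
Qed.

Lemma is_derive_parametric_cint a b (K : R -> R[i] -> R[i]) (dK : R -> R[i]) z (B : R) :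
  (\forall w \near z, continuous (K ^~ w)) -> continuous dK ->
  (\forall w \near z, forall t, between a b t ->
    modC (K t w - K t z - dK t * (w - z)) <= B * modC (w - z) ^+ 2) ->
  is_derive z 1 (fun w => cint a b (K ^~ w)) (cint a b dK).
Proof.
move=> cK cdK KB; apply: is_derive_modC => e e0.
pose A := `|B| * `|b - a| + 1; have A0 : 0 < A by rewrite ltr_wpDl ?mulr_ge0.
have wz : \forall w \near z, modC (w - z) < e / A.
  by apply/nbhs_modCP; exists (e / A); rewrite ?divr_gt0.
have cKz := nbhs_singleton cK.
apply: filterS3 cK KB wz => w cKw KBw /=; rewrite ltr_pdivlMr // mulrC => wz.
have cKB : continuous (fun t => K t w - K t z).
  by move=> t; exact: (CcontinuousB (cKw t) (cKz t)).
have cdKw : continuous (fun t => (w - z) * dK t).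
  by move=> t; exact: (CcontinuousM (@cst_continuous _ _ (w - z) t) (cdK t)).
rewrite [cint a b dK * _]mulrC -cintZ // -(cintB _ _ cKw cKz) -(cintB _ _ cKB cdKw).
apply: (@le_trans _ _ (`|B| * modC (w - z) ^+ 2 * `|b - a|)).
  apply: cint_bound => [t|t tab]; first exact: (CcontinuousB (cKB t) (cdKw t)).
  rewrite (mulrC (w - z)) (le_trans (KBw t tab)) //.
  by rewrite ler_wpM2r ?exprn_ge0 ?modC_ge0 // ler_norm.
rewrite (_ : _ * `|b - a| = (`|B| * `|b - a|) * modC (w - z) * modC (w - z)); last by ring.
rewrite ler_wpM2r ?modC_ge0 // (le_trans _ (ltW wz)) // ler_wpM2r ?modC_ge0 //.
by rewrite /A lerDl.
Qed.

Lemma modC_pow_second_order x y h (B : R) n : modC x <= B -> modC y <= B ->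
  y - x = h * x * y ->
  modC (y ^+ n - x ^+ n - n%:R * x ^+ n.+1 * h) <=
    n%:R ^+ 2 * B ^+ n.+2 * modC h ^+ 2.
Proof.
move=> xB yB yx; have B0 : 0 <= B := le_trans (modC_ge0 x) xB.
elim: n => [|n IHn]; first by rewrite subrr !mul0r subrr modC0 expr0n !mul0r.
pose E := y ^+ n - x ^+ n - n%:R * x ^+ n.+1 * h.
have -> : y ^+ n.+1 - x ^+ n.+1 - n.+1%:R * x ^+ n.+2 * h =
    y * E + n.+1%:R * (x ^+ n.+2 * y) * h ^+ 2.
  apply/eqP; rewrite -subr_eq0 /E -natr1 !exprS.
  rewrite (_ : _ - _ = x ^+ n * ((y - x) - h * x * y) * (1 + (n%:R + 1) * x * h)).
    by rewrite yx subrr mulr0 mul0r.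
  by ring.
have yE : modC (y * E) <= B * (n%:R ^+ 2 * B ^+ n.+2 * modC h ^+ 2).
  by rewrite modCM ler_pM ?modC_ge0.
have xy_le : modC (n.+1%:R * (x ^+ n.+2 * y) * h ^+ 2) <=
    n.+1%:R * (B ^+ n.+2 * B) * modC h ^+ 2.
  rewrite (modCM _ (h ^+ 2)) (modCX h) ler_wpM2r ?exprn_ge0 ?modC_ge0 //.
  rewrite (modCM n.+1%:R) modC_nat ler_wpM2l // (modCM (x ^+ n.+2)) (modCX x).
  by rewrite ler_pM ?exprn_ge0 ?modC_ge0 // lerXn2r ?nnegrE ?modC_ge0.
apply: le_trans (modCD _ _) _; apply: le_trans (lerD yE xy_le) _.
have -> : n.+1%:R ^+ 2 * B ^+ n.+3 * modC h ^+ 2 =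
    B * (n%:R ^+ 2 * B ^+ n.+2 * modC h ^+ 2) +
    n.+1%:R * (B ^+ n.+2 * B) * modC h ^+ 2 + n%:R * (B ^+ n.+2 * B) * modC h ^+ 2.
  by rewrite -natr1 (exprSr B n.+2); ring.
by rewrite lerDl mulr_ge0 ?exprn_ge0 ?modC_ge0 // mulr_ge0 // mulr_ge0 ?exprn_ge0.
Qed.

End ParametricIntegral.

Section CauchyIntegral.
Local Open Scope classical_set_scope.
Variable R : realType.
Implicit Types (r t : R) (phi : R -> R[i]) (z w : R[i]) (n : nat).

Definition cauchy_integral r phi n z : R[i] :=
  cint 0 (pi *+ 2) (fun t => phi t / (circle r t - z) ^+ n).

Lemma continuous_cauchy_kernel r phi n z : continuous phi -> modC z < r ->
  continuous (fun t => phi t / (circle r t - z) ^+ n).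
Proof.
move=> cphi zr t; apply: CcontinuousM; first exact: cphi.
apply: CcontinuousV; first by rewrite expf_neq0 // circleB_neq0.
apply: CcontinuousX; apply: CcontinuousB; first exact: continuous_circle.
exact: cst_continuous.
Qed.

Lemma is_derive_cauchy_integral r phi n z : continuous phi -> modC z < r ->
  is_derive z 1 (cauchy_integral r phi n) (n%:R * cauchy_integral r phi n.+1 z).
Proof.
move=> cphi zr; have [M M0 phiM] := continuous_bounded_curve 0 (pi *+ 2) cphi.
have r0 : 0 <= r := le_trans (modC_ge0 z) (ltW zr).
pose d := (r - modC z) / 2; have d0 : 0 < d by rewrite divr_gt0 ?subr_gt0.
have zd : modC z < r - d by rewrite /d; lra.
have kernel_le w t : modC w < r - d -> modC (circle r t - w)^-1 <= d^-1.
  move=> wd; rewrite modCV lef_pV2 ?posrE //.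
    by apply: le_trans (ler_circleB w t r0); lra.
  by rewrite modC_gt0 circleB_neq0 //; lra.
have wd := near_modC_lt zd.
have -> : n%:R * cauchy_integral r phi n.+1 z =
    cint 0 (pi *+ 2) (fun t => n%:R * (phi t / (circle r t - z) ^+ n.+1)).
  by rewrite cintZ; last exact: continuous_cauchy_kernel.
apply: (@is_derive_parametric_cint _ _ _ _ _ _ (M * (n%:R ^+ 2 * d^-1 ^+ n.+2))).
- by apply: filterS wd => w wd; apply: continuous_cauchy_kernel => //; lra.
- move=> t; apply: CcontinuousM; first exact: cst_continuous.
  exact: continuous_cauchy_kernel.
apply: filterS wd => w wd t t2pi; set x := (circle r t - z)^-1.
have xd : modC x <= d^-1 by exact: kernel_le.
set y := (circle r t - w)^-1; have yd : modC y <= d^-1 by exact: kernel_le.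
have yx : y - x = (w - z) * x * y.
  have uz : circle r t - z != 0 by exact: circleB_neq0.
  have uw : circle r t - w != 0 by apply: circleB_neq0; lra.
  by rewrite /x /y; field; rewrite uz uw.
rewrite -!exprVn -/x -/y (_ : _ - _ - _ =
  phi t * (y ^+ n - x ^+ n - n%:R * x ^+ n.+1 * (w - z))); last by ring.
rewrite modCM -(mulrA M) ler_pM ?modC_ge0 ?phiM //.
exact: modC_pow_second_order.
Qed.

(* The integrand of the derivative in [z] is the derivative in [t] of
   [i / (circle r t - z)]. *)
Lemma cauchy_integral_circle r z : modC z < r ->
  cauchy_integral r (circle r) 1 z = (pi *+ 2)%:C.
Proof.
move=> zr; have r0 : 0 < r := le_lt_trans (modC_ge0 z) zr.
rewrite (disk_cst _ zr) => [|w wr].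
  rewrite -[RHS]mul1r -[X in X%:C]subr0 -cint_cst; apply: eq_cint => t _.
  by rewrite subr0 expr1 divff // -modC_gt0 modC_circle // ltW.
rewrite -[0](_ : 1%:R * cauchy_integral r (circle r) 2 w = 0).
  by apply: is_derive_cauchy_integral => //; exact: continuous_circle.
rewrite /cauchy_integral (@cint_FTC _ _ _ _ (fun t => 'i * (circle r t - w)^-1)).
- by rewrite circle2pi subrr mulr0.
- by apply: continuous_cauchy_kernel => //; exact: continuous_circle.
move=> t; have uw : circle r t - w != 0 by exact: circleB_neq0.
rewrite (_ : circle r t / _ = - 'i / (circle r t - w) ^+ 2 * ('i * circle r t)).
  apply: (@is_derive_curve_comp _ _ _ (fun u => 'i * (u - w)^-1)).
    have dV : is_derive (circle r t) 1 (fun u => u - w) 1.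
      by apply: is_derive_eq; rewrite subr0.
    have -> : - 'i = 0 * (circle r t - w) - 'i * 1 by rewrite mul0r sub0r mulr1.
    exact: (@is_derive_div _ (fun=> 'i) (fun u => u - w) _ _ _ uw _ dV).
  exact: is_derive_curve_circle.
rewrite [RHS](_ : _ = - 'i ^+ 2 * (circle r t / (circle r t - w) ^+ 2)).
  by rewrite sqr_i opprK mul1r.
by field.
Qed.

End CauchyIntegral.

Section CauchyFormula.
Local Open Scope classical_set_scope.
Variable R : realType.
Implicit Types (f : R[i] -> R[i]) (r rho t : R) (z w : R[i]).

Lemma derivable_slope f z w : w != z -> derivable f w 1 ->
  derivable (slope f z) w 1.
Proof.
move=> wz df; have wz0 : 0 < modC (w - z) by rewrite modC_gt0 subr_eq0.
have dq : derivable (fun u => (f u - f z) / (u - z)) w 1.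
  apply: CderivableM; first by apply: CderivableB; [exact: df|exact: derivable_cst].
  apply: CderivableV; first by rewrite subr_eq0.
  by apply: CderivableB; [exact: derivable_id|exact: derivable_cst].
apply: near_eq_derivable dq; apply/nbhs_modCP; exists (modC (w - z)) => // u.
rewrite /slope; case: eqP => // ->; by rewrite modCBC ltxx.
Qed.

Lemma continuous_slope_disk f rho z w : holomorphic rho f ->
  modC z < rho -> modC w < rho -> {for w, continuous (slope f z)}.
Proof.
move=> df zr wr; have [->|wz] := eqVneq w z; first exact: (continuous_slope (df z zr)).
exact: (derivable_Ccontinuous (derivable_slope wz (df w wr))).
Qed.

Lemma continuous_on_circle f r rho : holomorphic rho f -> 0 <= r < rho ->
  continuous (fun t => f (circle r t)).
Proof.
move=> df /andP[r0 rr] t; apply: (@continuous_comp _ _ _ (circle r)).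
  exact: continuous_circle.
by apply: (holomorphic_continuous df); rewrite modC_circle.
Qed.

Theorem cauchy_formula f r rho z : holomorphic rho f -> modC z < r < rho ->
  (pi *+ 2)%:C * f z = cauchy_integral r (fun t => f (circle r t) * circle r t) 1 z.
Proof.
move=> df /andP[zr rr]; have r0 := le_lt_trans (modC_ge0 z) zr.
have zrho := lt_trans zr rr.
pose q := slope f z.
have dQ w : modC w < rho -> is_derive w 1 (primitive q) (q w).
  apply: (@is_derive_primitive _ _ z) => u ur; first exact: (continuous_slope_disk df).
  by move=> uz; apply: derivable_slope uz _; exact: df.
have cf : continuous (fun t => f (circle r t)).
  by apply: (continuous_on_circle df); rewrite ltW.
have cfc : continuous (fun t => f (circle r t) * circle r t).
  by move=> t; apply: CcontinuousM; [exact: cf|exact: continuous_circle].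
pose k t := f (circle r t) * circle r t / (circle r t - z) ^+ 1.
have ck : continuous k := @continuous_cauchy_kernel _ _ _ 1 _ cfc zr.
pose k0 t := circle r t / (circle r t - z) ^+ 1.
have ck0 : continuous k0 := @continuous_cauchy_kernel _ _ _ 1 _ (@continuous_circle _ r) zr.
have cfk0 : continuous (fun t => f z * k0 t).
  by move=> t; apply: CcontinuousM; [exact: cst_continuous|exact: ck0].
have ckk0 : continuous (fun t => k t - f z * k0 t).
  by move=> t; exact: (CcontinuousB (ck t) (cfk0 t)).
have : cint 0 (pi *+ 2) (fun t => 'i * (k t - f z * k0 t)) = 0.
  rewrite (@cint_FTC _ _ _ _ (fun t => primitive q (circle r t))).
  - by rewrite circle2pi subrr.
  - by move=> t; apply: CcontinuousM; [exact: cst_continuous|exact: ckk0].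
  move=> t; have uz := circleB_neq0 t zr.
  have -> : 'i * (k t - f z * k0 t) = q (circle r t) * ('i * circle r t).
    apply: (mulIf uz); rewrite [RHS]mulrAC -slopeE /k /k0; field.
    exact: uz.
  have dQt : is_derive (circle r t) 1 (primitive q) (q (circle r t)).
    by apply: dQ; rewrite modC_circle // ltW.
  exact: is_derive_curve_comp dQt (is_derive_curve_circle r t).
rewrite (cintZ _ _ _ ckk0) (cintB _ _ ck cfk0) (cintZ _ _ _ ck0) => /eqP.
rewrite mulf_eq0 -modC_eq0 modCi oner_eq0 /= subr_eq0 => /eqP kE.
by rewrite -(cauchy_integral_circle zr) mulrC /cauchy_integral -/k0 -kE.
Qed.

End CauchyFormula.

(** * Consequences of Cauchy's formula *)

Section HolomorphicTheory.
Local Open Scope classical_set_scope.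
Variable R : realType.
Implicit Types (f q : R[i] -> R[i]) (r rho : R) (z w : R[i]).

Theorem holomorphic_cderiv rho f : holomorphic rho f -> holomorphic rho (cderiv f).
Proof.
move=> df z zrho; have [r [r0 zr rr]] := ex_radius zrho.
pose phi t := f (circle r t) * circle r t.
have cphi : continuous phi.
  move=> t; apply: CcontinuousM; last exact: continuous_circle.
  by apply: (continuous_on_circle df); rewrite ltW.
pose c : R[i] := (pi *+ 2)%:C^-1.
have fE w : modC w < r -> f w = c * cauchy_integral r phi 1 w.
  move=> wr; rewrite -(cauchy_formula df); last by rewrite wr.
  by rewrite mulKf // -modC_gt0 modC_real gtr0_norm pi2_gt0.
have dfE w : modC w < r -> is_derive w 1 f (c * cauchy_integral r phi 2 w).
  move=> wr; have dI := is_derive_cauchy_integral 1 cphi wr; rewrite mul1r in dI.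
  have dcI : is_derive w 1 (fun u => c * cauchy_integral r phi 1 u)
    (c * cauchy_integral r phi 2 w).
    by apply: is_derive_eq; rewrite /GRing.scale /=; ring.
  apply: near_eq_is_derive dcI; apply: filterS (near_modC_lt wr) => u ur.
  by rewrite fE.
have dI2 : derivable (fun w => c * cauchy_integral r phi 2 w) z 1.
  apply: CderivableM; first exact: derivable_cst.
  by have [] := is_derive_cauchy_integral 2 cphi zr.
apply: near_eq_derivable dI2; apply: filterS (near_modC_lt zr) => w wr.
by rewrite /cderiv; have [_ ->] := dfE w wr.
Qed.

Theorem removable_singularity rho q z0 :
  (forall z, modC z < rho -> {for z, continuous q}) ->
  (forall z, modC z < rho -> z != z0 -> derivable q z 1) -> holomorphic rho q.
Proof.
move=> cq dq; have dQ := is_derive_primitive cq dq.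
apply: (@eq_holomorphic _ _ (cderiv (primitive q))) => [z /dQ[]//|].
exact: holomorphic_cderiv (is_derive_holomorphic dQ).
Qed.

Lemma holomorphic_slope rho f z :
  modC z < rho -> holomorphic rho f -> holomorphic rho (slope f z).
Proof.
move=> zrho df; apply: (@removable_singularity _ _ z) => w wr.
  exact: continuous_slope_disk df _ wr.
by move=> wz; apply: derivable_slope wz (df w wr).
Qed.

Lemma holomorphic_primitive rho f z :
  holomorphic rho f -> modC z < rho -> is_derive z 1 (primitive f) (f z).
Proof.
move=> df; apply: (@is_derive_primitive _ _ 0) => w wr; last by move=> _; exact: df.
exact: holomorphic_continuous df wr.
Qed.

Lemma expr_bounded_le1 (a K : R) : (forall n, a ^+ n <= K) -> a <= 1.
Proof.
move=> aK; rewrite leNgt; apply/negP => a1; have a0 : 0 < a by lra.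
have : `|a^-1| < 1 by rewrite gtr0_norm ?invr_gt0 // invf_lt1.
move=> /(cvg_geometric K) K0.
have [n _ /(_ n (leqnn n))] := @cvgr_lt _ _ _ _ _ _ K0 _ ltr01.
by rewrite /= exprVn ltr_pdivrMr ?exprn_gt0 // mul1r ltNge aK.
Qed.

(* Landau's trick: Cauchy's formula for [f ^+ n] loses a constant independent
   of [n], which disappears on taking [n]-th roots. *)
Theorem maximum_principle rho r f (M : R) z : holomorphic rho f ->
  modC z < r < rho -> (forall t, modC (f (circle r t)) <= M) -> modC (f z) <= M.
Proof.
move=> df zr_rr fM; have [zr rr] := andP zr_rr.
have r0 : 0 < r := le_lt_trans (modC_ge0 z) zr.
have M0 : 0 <= M := le_trans (modC_ge0 _) (fM 0).
pose K := r / (r - modC z); have zr0 : 0 < r - modC z by rewrite subr_gt0.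
have fnK n : modC (f z) ^+ n <= M ^+ n * K.
  have dfn : holomorphic rho (fun w => f w ^+ n).
    by move=> w /df; exact: CderivableX.
  rewrite -modCX -(ler_pM2l (pi2_gt0 R)).
  rewrite -{1}(gtr0_norm (pi2_gt0 R)) -modC_real -modCM (cauchy_formula dfn zr_rr).
  rewrite mulrC -[X in _ * X](gtr0_norm (pi2_gt0 R)) -[X in `|X|]subr0.
  have cfn : continuous (fun t => f (circle r t) ^+ n * circle r t).
    move=> t; apply: CcontinuousM; last exact: continuous_circle.
    by apply: (continuous_on_circle dfn); rewrite ltW.
  apply: cint_bound => [|t _]; first exact: continuous_cauchy_kernel.
  rewrite expr1 modCM (modCM (f _ ^+ n)) modCV modCX modC_circle ?(ltW r0) // -mulrA.
  rewrite ler_pM ?exprn_ge0 ?mulr_ge0 ?invr_ge0 ?modC_ge0 ?(ltW r0) //.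
    by rewrite lerXn2r ?nnegrE ?modC_ge0.
  rewrite ler_pM2l // lef_pV2 ?posrE //; first exact/ler_circleB/ltW.
  by rewrite modC_gt0 circleB_neq0.
have [M00|Mn0] := eqVneq M 0.
  by have := fnK 1%N; rewrite M00 !expr1 mul0r.
have {Mn0} M0 : 0 < M by rewrite lt_def Mn0.
rewrite -[leRHS]mul1r -ler_pdivrMr //; apply: (@expr_bounded_le1 _ K) => n.
by rewrite expr_div_n ler_pdivrMr ?exprn_gt0 // mulrC.
Qed.

Lemma closed_modC_le r : closed [set z : R[i] | modC z <= r].
Proof. by apply: preimage_closed (@closed_le _ r) => z _; exact: continuous_modC. Qed.

Lemma compact_closed_disk r : compact [set z : R[i] | modC z <= r].
Proof.
apply: (@subclosed_compact _ _ (box (- r) r (- r) r)).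
- exact: closed_modC_le.
- exact: compact_box.
move=> z /= zr; have r0 : 0 <= r := le_trans (modC_ge0 z) zr.
have rr : - r <= r by lra.
by split; rewrite between_le // -ler_norml (le_trans _ zr) ?Re_le_modC ?Im_le_modC.
Qed.

Lemma near_left1_unit : \forall t \near (1 : R)^'-, 0 < t < 1.
Proof.
near=> t; apply/andP; split; near: t; first exact: nbhs_left_gt.
exact: nbhs_left_lt.
Unshelve. all: by end_near. Qed.

Lemma ex_first_zero rho (u : R[i] -> R) :
  (forall z, modC z < rho -> {for z, continuous u}) -> 0 < u 0 ->
  (exists2 z, modC z < rho & u z <= 0) ->
  exists z0, [/\ z0 != 0, modC z0 < rho, u z0 = 0 &
     forall z, modC z <= modC z0 -> 0 <= u z].
Proof.
move=> cu u0 [z1 z1rho uz1]; pose s := modC z1.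
have neq0 z : u z <= 0 -> z != 0 by apply: contraTneq => ->; rewrite -ltNge.
have s0 : 0 < s by rewrite modC_gt0 neq0.
pose K := [set z : R[i] | modC z <= s] `&` [set z | u (retract s z) <= 0].
have KE z : modC z <= s -> u z <= 0 -> K z by move=> zs uz; split; rewrite //= retract_id.
have cK : compact K.
  apply: (@subclosed_compact _ _ [set z : R[i] | modC z <= s]); last first.
  - by move=> z [].
  - exact: compact_closed_disk.
  apply: closedI; first exact: closed_modC_le.
  apply: preimage_closed (@closed_le _ 0) => z _.
  apply: (@continuous_comp _ _ _ (retract s) u); first exact: continuous_retract.
  by apply: cu; exact: le_lt_trans (modC_retract z s0) z1rho.
have [|z0 /set_mem[/= z0s]] :=
    compact_EVT_min _ cK (continuous_subspaceT (@continuous_modC R)).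
  by exists z1; exact: KE.
rewrite retract_id // => uz0 z0_min; have z0n := neq0 _ uz0.
have u_pos z : modC z < modC z0 -> 0 < u z.
  move=> zz0; rewrite ltNge; apply: contraL (zz0) => uz; rewrite -leNgt z0_min //.
  by apply/mem_set/KE => //; exact/ltW/(lt_le_trans zz0).
have u_ge0 z : modC z <= modC z0 -> 0 <= u z.
  move=> zz0; pose v (t : R) := u (z * t%:C).
  have cv : v @ 1^'- --> u z.
    rewrite -[z in u z]mulr1 -[u _]/(v 1); apply: cvg_at_left_filter.
    apply: (@continuous_comp _ _ _ (fun t : R => z * t%:C)).
      exact: is_derive_curve_continuous (is_derive_curve_line z 1).
    by apply: cu; rewrite mulr1 (le_lt_trans zz0) // (le_lt_trans z0s).
  apply: cvgr_to_ge cv _; near=> t.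
  have t01 : 0 < t < 1 by near: t; exact: near_left1_unit.
  have [t0 t1] := andP t01; apply/ltW/u_pos.
  rewrite modCM modC_real gtr0_norm // (le_lt_trans (ler_wpM2r (ltW t0) zz0)) //.
  by rewrite gtr_pMr // modC_gt0.
exists z0; split => //; first exact: le_lt_trans z1rho.
by apply/eqP; rewrite eq_le uz0 u_ge0.
Unshelve. all: by end_near. Qed.

(* First-order conditions at [z0], along the circle and along the radius. *)
Lemma Re_boundary_zero rho f z0 : holomorphic rho f -> modC z0 < rho ->
  complex.Re (f z0) = 0 -> (forall z, modC z <= modC z0 -> 0 <= complex.Re (f z)) ->
  z0 * cderiv f z0 <= 0.
Proof.
move=> df z0rho fz0 f_ge0; pose l : R[i] := cderiv f z0; rewrite -/l.
have z0rot (t : R) : modC (z0 * expi t) = modC z0 by rewrite modCM modC_expi mulr1.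
pose rot (t : R) := complex.Re (f (z0 * expi t)).
have drot (t : R) :
    is_derive t 1 rot (complex.Re (cderiv f (z0 * expi t) * (z0 * ('i * expi t)))).
  have dft : is_derive (z0 * expi t) 1 f (cderiv f (z0 * expi t)).
    by apply: (holomorphic_is_derive df); rewrite z0rot.
  by have [] := is_derive_curve_comp dft (is_derive_curveZ z0 (is_derive_curve_expi t)).
have rot_min : is_derive (0 : R) 1 rot 0.
  apply: (@derive1_at_min R rot (-1) 1) => [|t _||t _].
  - by lra.
  - by have [] := drot t.
  - by rewrite in_itv /=; apply/andP; split; lra.
  - by rewrite /rot expi0 mulr1 fz0 f_ge0 // z0rot.
have Im0 : complex.Im (z0 * l) = 0.
  have := is_derive_unique (drot 0) rot_min; rewrite expi0 !mulr1 -/l.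
  by rewrite !ReImE /=; lra.
pose dil (t : R) := complex.Re (f (z0 * t%:C)).
have ddil : is_derive (1 : R) 1 dil (complex.Re (l * z0)).
  have df1 : is_derive (z0 * 1%:C) 1 f l.
    by rewrite mulr1; exact: holomorphic_is_derive df z0rho.
  by have [] := is_derive_curve_comp df1 (is_derive_curve_line z0 1).
have [q [dilE cq q1]] := (is_derive1_caratheodory _ _ _).1 ddil.
have dil1 : dil 1 = 0 by rewrite /dil mulr1.
have : complex.Re (l * z0) <= 0.
  rewrite -q1; apply: cvgr_to_le (cvg_at_left_filter cq) _; near=> t.
  have t01 : 0 < t < 1 by near: t; exact: near_left1_unit.
  have [t0 t1] := andP t01.
  have dil_ge0 : 0 <= dil t.
    apply: f_ge0; rewrite modCM modC_real gtr0_norm //.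
    by rewrite ler_piMr ?modC_ge0 // ltW.
  have : 0 <= q t * (t - 1) by rewrite -dilE dil1 subr0.
  by rewrite nmulr_lge0 // subr_lt0.
by rewrite lecE /= Im0 eqxx mulrC.
Unshelve. all: by end_near. Qed.

End HolomorphicTheory.

(** * Principal powers *)

Section PrincipalPower.
Local Open Scope classical_set_scope.
Variable R : realType.
Implicit Types (u z w : R[i]) (beta : R).

(* The last hypothesis is the Cauchy-Riemann equation. *)
Lemma is_derive_separated (phi psi : R -> R[i]) z k l :
  is_derive_curve (complex.Re z) phi k -> is_derive_curve (complex.Im z) psi l ->
  phi (complex.Re z) * l = 'i * (k * psi (complex.Im z)) ->
  is_derive z 1 (fun w => phi (complex.Re w) * psi (complex.Im w))
    (k * psi (complex.Im z)).
Proof.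
move=> dphi /is_derive_curveP[q [psiE cq ql]] CR.
have cphi := is_derive_curve_continuous dphi.
have /is_derive_curveP[p [phiE cp pk]] := dphi.
pose A w := p (complex.Re w) * psi (complex.Im z).
pose B w := phi (complex.Re w) * q (complex.Im w).
have cA : {for z, continuous A}.
  apply: CcontinuousM; last exact: cst_continuous.
  by apply: (@continuous_comp _ _ _ (@complex.Re R)); [exact: continuous_Re|exact: cp].
have cB : {for z, continuous B}.
  apply: CcontinuousM.
    by apply: (@continuous_comp _ _ _ (@complex.Re R)); [exact: continuous_Re|exact: cphi].
  by apply: (@continuous_comp _ _ _ (@complex.Im R)); [exact: continuous_Im|exact: cq].
apply: is_derive_modC => e e0; have e2 : 0 < e / 2 by rewrite divr_gt0.
move/continuous_modCP : cA => /(_ _ e2) nearA.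
move/continuous_modCP : cB => /(_ _ e2); apply: filterS2 nearA => w.
have -> : A z = k * psi (complex.Im z) by rewrite /A pk.
have -> : B z = 'i * (k * psi (complex.Im z)).
  by rewrite /B ql CR.
set m := k * psi _; set x := complex.Re w - complex.Re z.
set y := complex.Im w - complex.Im z => Aw Bw.
have wz : w - z = x%:C + 'i * y%:C by rewrite [LHS]complexE !ReImE.
rewrite (_ : _ - m * (w - z) = (A w - m) * x%:C + (B w - 'i * m) * y%:C); last first.
  transitivity ((phi (complex.Re w) - phi (complex.Re z)) * psi (complex.Im z) +
    phi (complex.Re w) * (psi (complex.Im w) - psi (complex.Im z)) - m * (w - z)).
    by ring.
  by rewrite phiE psiE -/x -/y wz /A /B; ring.
apply: le_trans (modCD _ _) _.
rewrite [X in _ <= X * _](splitr e) [leRHS]mulrDl.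
rewrite lerD // modCM modC_real ler_pM ?modC_ge0 ?(ltW Aw) ?(ltW Bw) //.
  by have := Re_le_modC (w - z); rewrite Re_add Re_opp.
by have := Im_le_modC (w - z); rewrite Im_add Im_opp.
Qed.

Definition cexp z : R[i] := (expR (complex.Re z))%:C * expi (complex.Im z).
Definition clog u : R[i] := ln (modC u) +i* Arg u.

Lemma modC_cexp z : modC (cexp z) = expR (complex.Re z).
Proof. by rewrite modCM modC_expi mulr1 modC_real gtr0_norm ?expR_gt0. Qed.

Lemma cexp_neq0 z : cexp z != 0.
Proof. by rewrite -modC_gt0 modC_cexp expR_gt0. Qed.

Lemma is_derive_cexp z : is_derive z 1 cexp (cexp z).
Proof.
apply: (@is_derive_separated (fun x => (expR x)%:C) (@expi R)).
- by split; rewrite /=; [exact: is_derive_expR|exact: is_derive_cst].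
- exact: is_derive_curve_expi.
by rewrite mulrCA.
Qed.

Lemma near_Re_gt0 u : 0 < complex.Re u -> \forall w \near u, 0 < complex.Re w.
Proof. by move=> u0; exact: cvgr_gt (@continuous_Re R u) _ u0. Qed.

Lemma Arg_Re_gt0 u : 0 < complex.Re u -> Arg u = atan (complex.Im u / complex.Re u).
Proof. by rewrite /Arg /ReC => ->. Qed.

Lemma cexp_clog u : 0 < complex.Re u -> cexp (clog u) = u.
Proof.
case: u => a b /= a0; have u0 : 0 < modC (a +i* b).
  by rewrite modC_gt0 eq_complex /= gt_eqF.
rewrite /cexp /= lnK ?posrE // Arg_Re_gt0 //= /expi; set t := atan _.
have ct : cos t != 0 by rewrite cos_atan invr_neq0 // sqrtr_eq0 -ltNge ltr_wpDr ?sqr_ge0.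
have st : sin t = b / a * cos t by rewrite -[b / a]atanK -/t /tan divfK.
have mt : modC (a +i* b) * cos t = a.
  rewrite cos_atan; apply: (canLR (mulfK _)).
    by rewrite sqrtr_eq0 -ltNge ltr_wpDr ?sqr_ge0.
  rewrite -{2}(gtr0_norm a0) -sqrtr_sqr -sqrtrM ?sqr_ge0 //; congr Num.sqrt.
  by rewrite /ReC /ImC /=; field; rewrite gt_eqF.
apply: complex_ext; rewrite !ReImE /= mul0r ?subr0 ?addr0 //.
by rewrite st mulrCA mt divfK ?gt_eqF.
Qed.

Lemma continuous_clog u : 0 < complex.Re u -> {for u, continuous clog}.
Proof.
move=> u0; have u1 : 0 < modC u.
  by rewrite (lt_le_trans u0) // (le_trans (ler_norm _)) ?Re_le_modC.
apply: continuous_Complex.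
  apply: (@continuous_comp _ _ _ (@modC R)); first exact: continuous_modC.
  exact: continuous_ln.
have near_Arg : {near u, (fun w => atan (complex.Im w / complex.Re w)) =1 @Arg R}.
  by apply: filterS (near_Re_gt0 u0) => w w0; rewrite Arg_Re_gt0.
apply: cvg_trans (near_eq_cvg near_Arg) _; rewrite Arg_Re_gt0 //.
apply: (@continuous_comp _ _ _ (fun w => complex.Im w / complex.Re w)); last first.
  exact: continuous_atan.
apply: continuousM; first exact: continuous_Im.
by apply: continuousV; [rewrite gt_eqF|exact: continuous_Re].
Qed.

Lemma is_derive_clog u : 0 < complex.Re u -> is_derive u 1 clog u^-1.
Proof.
move=> u0; apply: (@is_derive_right_inverse _ cexp).
- by rewrite -{2}(cexp_clog u0); exact: is_derive_cexp.
- by apply: contraTneq u0 => ->; rewrite ltxx.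
- exact: continuous_clog.
by apply: filterS (near_Re_gt0 u0) => w; exact: cexp_clog.
Qed.

Lemma cpowE u beta : u != 0 -> cpow u beta = cexp (beta%:C * clog u).
Proof.
move=> u0; rewrite /cpow (negbTE u0) /cexp !ReImE /= !mul0r subr0 addr0.
by rewrite /powR gt_eqF ?modC_gt0.
Qed.

Lemma cpow_neq0 u beta : u != 0 -> cpow u beta != 0.
Proof. by move=> u0; rewrite cpowE // cexp_neq0. Qed.

Lemma cpow1 beta : cpow 1 beta = 1 :> R[i].
Proof.
rewrite cpowE ?oner_neq0 // /clog modC1 ln1 Arg_Re_gt0 //= mul0r atan0.
by rewrite mulr0 /cexp /= expR0 expi0 mulr1.
Qed.

Lemma Re_gt0_neq0 u : 0 < complex.Re u -> u != 0.
Proof. by apply: contraTneq => ->; rewrite ltxx. Qed.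

Lemma is_derive_cpow u beta : 0 < complex.Re u ->
  is_derive u 1 (fun w => cpow w beta) (beta%:C * cpow u beta / u).
Proof.
move=> u0; have dlog := is_derive_clog u0.
have dblog : is_derive u 1 (fun w => beta%:C * clog w) (beta%:C / u).
  by apply: is_derive_eq; rewrite /GRing.scale /=; ring.
have := is_derive_comp dblog (is_derive_cexp _).
rewrite -cpowE ?Re_gt0_neq0 // mulrCA mulrA; apply: near_eq_is_derive.
by apply: filterS (near_Re_gt0 u0) => w w0; rewrite /= cpowE ?Re_gt0_neq0.
Qed.

Lemma Re_onem_gt0 w : modC w < 1 -> 0 < complex.Re (1 - w).
Proof.
move=> w1; rewrite !ReImE /= subr_gt0 (le_lt_trans _ w1) //.
exact: le_trans (ler_norm _) (Re_le_modC w).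
Qed.

Lemma onem_neq0 w : modC w < 1 -> 1 - w != 0.
Proof. by move/Re_onem_gt0/Re_gt0_neq0. Qed.

End PrincipalPower.

(** * First boundary points *)

Section BoundaryPoint.
Local Open Scope classical_set_scope.
Variable R : realType.
Implicit Types (f g w P : R[i] -> R[i]) (rho m : R) (u z q l : R[i]).

Lemma cderivE f z l : is_derive z 1 f l -> cderiv f z = l.
Proof. by case. Qed.

Lemma cderiv_slope rho f z : holomorphic rho f -> modC z < rho ->
  cderiv f z = cderiv (slope f 0) z * z + slope f 0 z.
Proof.
move=> df zrho; have rho0 : modC (0 : R[i]) < rho.
  by rewrite modC0 (le_lt_trans (modC_ge0 z)).
have dp := holomorphic_is_derive (holomorphic_slope rho0 df) zrho.
rewrite {1}(_ : f = fun u => slope f 0 u * u + f 0); last first.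
  by apply/funext => u; have := slopeE f 0 u; rewrite subr0 => <-; rewrite subrK.
by apply/cderivE/is_derive_eq; rewrite /GRing.scale /=; ring.
Qed.

Lemma jack rho w z0 : holomorphic rho w -> w 0 = 0 -> modC z0 < rho ->
  w z0 != 0 -> (forall z, modC z <= modC z0 -> modC (w z) <= modC (w z0)) ->
  1 <= z0 * cderiv w z0 / w z0.
Proof.
move=> dw w0 z0rho wz0 w_max; pose v := slope w 0.
have z0_neq0 : z0 != 0 by apply: contraNneq wz0 => ->; rewrite w0.
have z0_gt0 : 0 < modC z0 by rewrite modC_gt0.
have dv : holomorphic rho v by apply: holomorphic_slope; rewrite ?modC0 ?(lt_trans z0_gt0).
have wE z : w z = v z * z by have := slopeE w 0 z; rewrite w0 !subr0.
have vz0 : v z0 != 0 by move: wz0; rewrite wE mulf_eq0 negb_or => /andP[].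
have v_max z : modC z <= modC z0 -> modC (v z) <= modC (v z0).
  have v_circle u : modC u = modC z0 -> modC (v u) <= modC (v z0).
    move=> uz0; have := w_max u; rewrite !wE !modCM uz0 lexx => /(_ isT).
    by rewrite ler_pM2r.
  rewrite le_eqVlt => /predU1P[/v_circle//|zz0].
  have zz0rho : modC z < modC z0 < rho by rewrite zz0 z0rho.
  by apply: (maximum_principle dv zz0rho) => t; rewrite v_circle // modC_circle ?ltW.
have dvz0 := holomorphic_is_derive dv z0rho.
pose f z := 1 - v z / v z0.
have dfz0 : cderiv f z0 = - (cderiv v z0 / v z0).
  by apply/cderivE/is_derive_eq; rewrite /GRing.scale /=; ring.
have := @Re_boundary_zero _ rho f z0; rewrite dfz0 (cderiv_slope dw z0rho) wE -/v.
rewrite (_ : z0 * (cderiv v z0 * z0 + v z0) / (v z0 * z0) =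
    1 - z0 * - (cderiv v z0 / v z0)).
  rewrite lerDl oppr_ge0; apply; first last.
  - move=> z /v_max vz; rewrite Re_add Re_opp subr_ge0; apply: le_trans (ler_norm _) _.
    by apply: le_trans (Re_le_modC _) _; rewrite modCM modCV ler_pdivrMr ?modC_gt0 // mul1r.
  - by rewrite /f divff // subrr.
  - exact: z0rho.
  move=> z /dv dvz; apply: CderivableB; first exact: derivable_cst.
  by apply: CderivableM dvz _; exact: derivable_cst.
by move: (cderiv v z0) (v z0) vz0 => a b b0; field; rewrite b0 z0_neq0.
Qed.

Lemma modC_lt1_of_boundary rho w : holomorphic rho w -> w 0 = 0 ->
  (forall z m, modC z < rho -> modC (w z) = 1 -> 1 <= m ->
     z * cderiv w z <> m%:C * w z) ->
  forall z, modC z < rho -> modC (w z) < 1.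
Proof.
move=> dw w0 no_boundary z zrho; rewrite ltNge; apply/negP => wz1.
have [z' z'rho|||z0 [z0_neq0 z0rho /eqP uz0 u_ge0]] :=
    @ex_first_zero _ rho (fun z => 1 - modC (w z)).
- apply: continuousB; first exact: cst_continuous.
  apply: (@continuous_comp _ _ _ w); last exact: continuous_modC.
  exact: holomorphic_continuous dw z'rho.
- by rewrite w0 modC0 subr0.
- by exists z; rewrite // subr_le0.
rewrite subr_eq0 eq_sym in uz0; have wz0 : w z0 != 0 by rewrite -modC_gt0 (eqP uz0).
have /= := jack dw w0 z0rho wz0.
rewrite (eqP uz0) => /(_ (fun z zz0 => etrans (esym (subr_ge0 _ _)) (u_ge0 z zz0))).
set q := _ / _ => q1; apply: (no_boundary z0 (complex.Re q)) (eqP uz0) _ _ => //.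
  by move: q1; rewrite lecE => /andP[].
rewrite (_ : (complex.Re q)%:C = q) /q ?divfK //.
by apply: complex_ext => //; move: q1; rewrite lecE => /andP[/eqP].
Qed.

Lemma Re_gt0_of_boundary rho P : holomorphic rho P -> 0 < complex.Re (P 0) ->
  (forall z m, modC z < rho -> complex.Re (P z) = 0 -> 0 <= m ->
     z * cderiv P z <> - m%:C) ->
  forall z, modC z < rho -> 0 < complex.Re (P z).
Proof.
move=> dP P0 no_boundary z zrho; rewrite ltNge; apply/negP => Pz.
have [z' z'rho|||z0 [_ z0rho Pz0 P_ge0]] :=
    @ex_first_zero _ rho (fun z => complex.Re (P z)).
- apply: (@continuous_comp _ _ _ P); last exact: continuous_Re.
  exact: holomorphic_continuous dP z'rho.
- exact: P0.
- by exists z.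
have := Re_boundary_zero dP z0rho Pz0 P_ge0; set q := z0 * _.
rewrite lecE => /andP[/eqP Imq Req].
apply: (no_boundary z0 (- complex.Re q)) => //; first by rewrite oppr_ge0.
by rewrite -/q -rmorphN opprK; apply: complex_ext => //=; rewrite -Imq.
Qed.

Lemma Re_inv_onem z : z != 1 -> complex.Re (1 - z)^-1 =
  (1 + (1 - modC z ^+ 2) / modC (1 - z) ^+ 2) / 2.
Proof.
rewrite eq_sym -subr_eq0 -modC_gt0 => /(exprn_gt0 2).
by rewrite !modC_sqr; case: z => a b /=; rewrite sub0r => ab; field; rewrite gt_eqF.
Qed.

Lemma Re_mobius_le0 z q m : modC z = 1 -> 1 <= m ->
  1 + m%:C * z = (1 - z) * q -> complex.Re q <= 0.
Proof.
move=> z1 m1 mz; have z_neq1 : z != 1.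
  apply/eqP => z_eq1; have := congr1 (@complex.Re R) mz.
  by rewrite z_eq1 subrr mul0r !ReImE /=; lra.
have onem_z0 : 1 - z != 0 by rewrite subr_eq0 eq_sym.
have -> : q = (1 + m%:C) * (1 - z)^-1 - m%:C.
  by apply: (mulfI onem_z0); rewrite -mz; field.
by rewrite Re_add Re_opp Re_mul /= Re_inv_onem // z1 expr1n subrr mul0r; lra.
Qed.

Lemma Re_inv_gt0 z : 0 < complex.Re z -> 0 < complex.Re z^-1.
Proof.
case: z => a b /= a0; apply: divr_gt0 => //.
by rewrite ltr_pwDl ?exprn_gt0 // sqr_ge0.
Qed.

End BoundaryPoint.

(** * Convex and close-to-convex functions *)

Section CloseToConvex.
Local Open Scope classical_set_scope.
Variable R : realType.
Implicit Types (f g F G : R[i] -> R[i]) (beta : R) (u z k : R[i]).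

Lemma Re_inv_onem_gt z : modC z < 1 -> 1 / 2 < complex.Re (1 - z)^-1.
Proof.
move=> z1; have z_neq1 := onem_neq0 z1.
rewrite Re_inv_onem; last by rewrite eq_sym -subr_eq0.
rewrite ltr_pM2r ?invr_gt0 // ltrDl divr_gt0 ?exprn_gt0 ?modC_gt0 //.
by rewrite subr_gt0 expr_lt1 ?modC_ge0.
Qed.

Theorem marx_strohhacker g z : classK g -> modC z < 1 ->
  1 / 2 < complex.Re (cderiv g z / slope g 0 z).
Proof.
move=> [[dg _] [dg_neq0 Q_gt0]]; pose p := slope g 0.
have dp : holomorphic 1 p := holomorphic_slope (modC0_lt1 R) dg.
have ddg : holomorphic 1 (cderiv g) := holomorphic_cderiv dg.
(* [z g' / g = 1 / (1 - w)], so the claim amounts to [|w| < 1]. *)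
pose w u := 1 - p u / cderiv g u.
have dw : holomorphic 1 w.
  move=> u u1; apply: CderivableB; first exact: derivable_cst.
  by apply: CderivableM (dp u u1) _; apply: CderivableV (ddg u u1); exact: dg_neq0.
have wQ u : modC u < 1 ->
    1 + u * cderiv w u = (1 - w u) * (1 + u * cderiv (cderiv g) u / cderiv g u).
  move=> u1; have g'u := dg_neq0 u u1.
  have dpgu := is_derive_div g'u
    (holomorphic_is_derive dp u1) (holomorphic_is_derive ddg u1).
  rewrite (_ : cderiv w u = - ((cderiv p u * cderiv g u - p u * cderiv (cderiv g) u) /
    cderiv g u ^+ 2)); last by apply/cderivE/is_derive_eq; rewrite sub0r.
  have pu : p u = cderiv g u - cderiv p u * u by rewrite (cderiv_slope dg u1) addrC addKr.
  rewrite /w subKr pu; move: (cderiv g u) (cderiv _ _) (cderiv _ _) g'u => a b c a0.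
  by field.
have w1 u : modC u < 1 -> modC (w u) < 1.
  apply: modC_lt1_of_boundary dw _ _ u => [|u m u1 wu1 m1 dwu].
    by rewrite /w /p slopexx divff ?subrr //; exact: dg_neq0 (modC0_lt1 R).
  have := Q_gt0 u u1; rewrite /ReC ltNge (Re_mobius_le0 wu1 m1) //.
  by rewrite -dwu wQ.
move=> z1; have := Re_inv_onem_gt (w1 z z1).
by rewrite /w subKr invf_div.
Qed.

Lemma convex_slope_neq0 g z : classK g -> modC z < 1 -> slope g 0 z != 0.
Proof.
move=> Kg /(marx_strohhacker Kg); apply: contraTneq => ->.
by rewrite invr0 mulr0 /= -leNgt; lra.
Qed.

Theorem libera f g k : holomorphic 1 f -> classK g ->
  (forall z, modC z < 1 -> 0 < complex.Re (k * cderiv f z / cderiv g z)) ->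
  forall z, modC z < 1 -> 0 < complex.Re (k * slope f 0 z / slope g 0 z).
Proof.
move=> df Kg fg_gt0; have [[dg _] [dg_neq0 _]] := Kg.
have dpf := holomorphic_slope (modC0_lt1 R) df.
have dpg := holomorphic_slope (modC0_lt1 R) dg.
have dk u : is_derive u 1 (fun=> k) 0 by exact: is_derive_cst.
have dkpf u : modC u < 1 ->
    is_derive u 1 (fun z => k * slope f 0 z) (k * cderiv (slope f 0) u).
  move=> u1; have dpfu := holomorphic_is_derive dpf u1.
  by apply: is_derive_eq; rewrite /GRing.scale /=; ring.
pose P u := k * slope f 0 u / slope g 0 u.
have dP u (u1 : modC u < 1) : is_derive u 1 P _ :=
  is_derive_div (convex_slope_neq0 Kg u1) (dkpf u u1) (holomorphic_is_derive dpg u1).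
have ratioE u : modC u < 1 -> k * cderiv f u / cderiv g u =
    P u + (slope g 0 u / cderiv g u) * (u * cderiv P u).
  move=> u1; rewrite (cderivE (dP u u1)) /P (cderiv_slope df u1).
  have := dg_neq0 u u1; have := convex_slope_neq0 Kg u1; rewrite (cderiv_slope dg u1).
  move: (slope g 0 u) (slope f 0 u) (cderiv _ u) (cderiv _ u) => pg pf dpgu dpfu pg0 dgu0.
  by field; rewrite pg0 dgu0.
apply: (@Re_gt0_of_boundary _ 1 P) => [||z m z1 Pz m0 dPz].
- exact: is_derive_holomorphic dP.
- by rewrite /P !slopexx; exact: fg_gt0 (modC0_lt1 R).
have lam_gt0 : 0 < complex.Re (slope g 0 z / cderiv g z).
  by rewrite -invf_div Re_inv_gt0 // (lt_trans _ (marx_strohhacker Kg z1)) //; lra.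
have := fg_gt0 z z1; rewrite (ratioE z z1) dPz Re_add Pz Re_mul /=; nra.
Qed.

(* The integrand [f w / (w (1 - w)^beta)], with its singularity at [0] removed. *)
Definition Cbeta_integrand beta f z := slope f 0 z / cpow (1 - z) beta.

Lemma is_derive_cpow_onem beta z : modC z < 1 ->
  is_derive z 1 (fun u => cpow (1 - u) beta) (- (beta%:C * cpow (1 - z) beta / (1 - z))).
Proof.
move=> z1; have donem : is_derive z 1 (fun u : R[i] => 1 - u) (-1).
  by apply: is_derive_eq; rewrite sub0r.
rewrite -mulrN1; exact: is_derive_comp donem (is_derive_cpow beta (Re_onem_gt0 z1)).
Qed.

Lemma holomorphic_Cbeta_integrand beta f :
  holomorphic 1 f -> holomorphic 1 (Cbeta_integrand beta f).
Proof.
move=> df z z1; apply: CderivableM.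
  exact: holomorphic_slope (modC0_lt1 R) df z z1.
apply: CderivableV; first by rewrite cpow_neq0 ?onem_neq0.
by have [] := is_derive_cpow_onem beta z1.
Qed.

Lemma Cbeta_integrandE beta f z : f 0 = 0 -> z != 0 ->
  Cbeta_integrand beta f z = f z / (z * cpow (1 - z) beta).
Proof.
move=> f0 z0; rewrite invfM mulrA /Cbeta_integrand; congr (_ / _).
by rewrite /slope (negbTE z0) f0 !subr0.
Qed.

Lemma is_Cbeta_primitive beta f : holomorphic 1 f -> f 0 = 0 ->
  is_Cbeta beta f (primitive (Cbeta_integrand beta f)).
Proof.
move=> /(@holomorphic_Cbeta_integrand beta) df f0.
have dF z (z1 : modC z < 1) := holomorphic_primitive df z1.
split; first by move=> z /dF[].
split=> [|z z1 z0]; first exact: primitive0.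
by rewrite (cderivE (dF z z1)) Cbeta_integrandE.
Qed.

Lemma eq_continuous_punctured f g z :
  {for z, continuous f} -> {for z, continuous g} -> {near z^', f =1 g} -> f z = g z.
Proof.
move=> /continuous_withinNx cf /continuous_withinNx cg fg.
exact: (cvg_unique (@norm_hausdorff _ R[i]) (cvg_trans (near_eq_cvg fg) cf) cg).
Qed.

Lemma is_Cbeta_cderiv beta f F : holomorphic 1 f -> f 0 = 0 -> is_Cbeta beta f F ->
  forall z, modC z < 1 -> cderiv F z = Cbeta_integrand beta f z.
Proof.
move=> df f0 [dF [_ dFE]].
have off0 z : modC z < 1 -> z != 0 -> cderiv F z = Cbeta_integrand beta f z.
  by move=> z1 z0; rewrite dFE // Cbeta_integrandE.
move=> z z1; have [->|] := eqVneq z 0; last exact: off0.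
apply: eq_continuous_punctured.
- exact: holomorphic_continuous (holomorphic_cderiv dF) (modC0_lt1 R).
- exact: holomorphic_continuous (holomorphic_Cbeta_integrand df) (modC0_lt1 R).
near=> u; apply: off0; near: u; last exact: nbhs_dnbhs_neq.
exact: nbhs_dnbhs (near_modC_lt (modC0_lt1 R)).
Unshelve. all: by end_near. Qed.

Lemma classA_Cbeta beta f F : classA f -> is_Cbeta beta f F -> classA F.
Proof.
move=> [df [f0 df0]] CF; have [dF [F0 _]] := CF.
split; [exact: dF|split; first exact: F0].
rewrite (is_Cbeta_cderiv df f0 CF) ?modC0 // /Cbeta_integrand slopexx.
by rewrite [X in X / _]df0 subr0 cpow1 divr1.
Qed.

Lemma classK_Cbeta beta g G : 0 <= beta <= 1 ->
  classK g -> is_Cbeta beta g G -> classK G.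
Proof.
move=> /andP[beta0 beta1] Kg CG; have [Ag [dg_neq0 _]] := Kg; have [dg [g0 _]] := Ag.
have dGE := is_Cbeta_cderiv dg g0 CG.
have pow_neq0 z : modC z < 1 -> cpow (1 - z) beta != 0.
  by move=> z1; rewrite cpow_neq0 ?onem_neq0.
split; first exact: classA_Cbeta CG.
split=> z z1.
  by rewrite dGE // mulf_neq0 ?invr_neq0 ?convex_slope_neq0 ?pow_neq0.
have dpz := holomorphic_is_derive (holomorphic_slope (modC0_lt1 R) dg) z1.
have dI := is_derive_div (pow_neq0 z z1) dpz (is_derive_cpow_onem beta z1).
have /near_eq_is_derive/(_ dI)/cderivE ddG :
    \near z, Cbeta_integrand beta g z = cderiv G z.
  by apply: filterS (near_modC_lt z1) => u u1; rewrite dGE.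
have z_neq1 := onem_neq0 z1; have powz := pow_neq0 z z1.
have pz := convex_slope_neq0 Kg z1.
have -> : 1 + z * cderiv (cderiv G) z / cderiv G z =
    cderiv g z / slope g 0 z + beta%:C * ((1 - z)^-1 - 1).
  rewrite ddG dGE // (cderiv_slope dg z1) /Cbeta_integrand.
  move: (slope g 0 z) (cderiv _ z) (cpow _ _) pz powz => p dp c p0 c0.
  by field; rewrite z_neq1 c0 p0.
have := marx_strohhacker Kg z1; have := Re_inv_onem_gt z1.
by rewrite /ReC Re_add (Re_mul beta%:C) Re_add Re_opp /= mul0r subr0; nra.
Qed.

End CloseToConvex.

Theorem theorem2p16 (R : realType) (beta : R) (hbeta : 0 <= beta <= 1)
  (f : (R[i])^o -> (R[i])^o) (hf : close_to_convex f) :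
  (exists F : (R[i])^o -> (R[i])^o, is_Cbeta beta f F) /\
  (forall F : (R[i])^o -> (R[i])^o, is_Cbeta beta f F -> close_to_convex F).
Proof.
have [Af [g [Kg [alpha [alpha_range fg_gt0]]]]] := hf.
have [df [f0 _]] := Af; have [[dg [g0 _]] _] := Kg.
have Cf := is_Cbeta_primitive beta df f0; have CG := is_Cbeta_primitive beta dg g0.
split=> [|F CF]; first by eexists; exact: Cf.
split; first exact: classA_Cbeta Af CF.
exists (primitive (Cbeta_integrand beta g)); split; first exact: classK_Cbeta hbeta Kg CG.
exists alpha; split=> [|z z1]; first exact: alpha_range.
have := libera df Kg fg_gt0 z1.
rewrite (is_Cbeta_cderiv df f0 CF) // (is_Cbeta_cderiv dg g0 CG) // /ReC.
by rewrite /Cbeta_integrand mulrA -mulf_div divff ?mulr1 // invr_neq0 ?cpow_neq0 ?onem_neq0.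
Qed.
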